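(* Let $X$ be a Banach space with a Schauder basis and $k\in\mathbb{N}$. Suppose that $\mathcal{SM}^{wrc}_k(X)$ contains a sequence equivalent to the usual basis of $\ell^1$. Then there exists a plegma block $k$-sequence in $X$ which generates a $k$-spreading model equivalent to the usual basis of $\ell^1$.
   Context: $[M]^k$: $k$-subsets of $M\subseteq\mathbb{N}$ (increasing enumerations, $M(l)$ the $l$-th element). A $k$-sequence in $X$ is a map $[\mathbb{N}]^k\to X$, $s\mapsto x_s$. Plegma family: $(s_j)_{j=1}^l$ in $[M]^k$ with $s_1(i)<\dots<s_l(i)$ ($i\le k$), $s_l(i)<s_1(i+1)$ ($i<k$); plegma pair = plegma family of length 2. $(x_s)_{s\in[M]^k}$ generates the Hamel basis $(e_n)$ of a seminormed space $(E,\|\cdot\|_* )$ as a $k$-spreading model if for a null sequence $\delta_l>0$: $|\|\sum_{j=1}^m a_jx_{s_j}\|-\|\sum_{j=1}^m a_je_j\|_*|\le\delta_l$ for all $m\le l$, plegma $(s_j)_{j=1}^m$ in $[M]^k$ with $s_1(1)\ge M(l)$, $a_j\in[-1,1]$. A $k$-sequence is weakly relatively compact if the weak closure of $\{x_s:s\in[\mathbb{N}]^k\}$ is weakly compact; $\mathcal{SM}^{wrc}_k(X)$ is the set of spreading sequences generated as $k$-spreading models by weakly relatively compact $k$-sequences in $X$. A $k$-sequence $(x_s)$ in $X$ is plegma block if each $x_s$ is finitely supported w.r.t. the basis and $\max\mathrm{supp}(x_{s_1})<\min\mathrm{supp}(x_{s_2})$ for every plegma pair $(s_1,s_2)$ in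 $[\mathbb{N}]^k$. *)

(* Defs.v *)
From Stdlib Require Import Reals List.
Open Scope R_scope.

Record SeminormedSpace := {
  sn_car :> Type;
  sn_zero : sn_car;
  sn_add : sn_car -> sn_car -> sn_car;
  sn_opp : sn_car -> sn_car;
  sn_scal : R -> sn_car -> sn_car;
  sn_norm : sn_car -> R;
  sn_add_assoc : forall x y z, sn_add x (sn_add y z) = sn_add (sn_add x y) z;
  sn_add_comm : forall x y, sn_add x y = sn_add y x;
  sn_add_zero : forall x, sn_add x sn_zero = x;
  sn_add_opp : forall x, sn_add x (sn_opp x) = sn_zero;
  sn_scal_assoc : forall a b x, sn_scal a (sn_scal b x) = sn_scal (a * b) x;
  sn_scal_one : forall x, sn_scal 1 x = x;
  sn_scal_distr_l : forall a x y, sn_scal a (sn_add x y) = sn_add (sn_scal a x) (sn_scal a y);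
  sn_scal_distr_r : forall a b x, sn_scal (a + b) x = sn_add (sn_scal a x) (sn_scal b x);
  sn_norm_homog : forall a x, sn_norm (sn_scal a x) = Rabs a * sn_norm x;
  sn_norm_triangle : forall x y, sn_norm (sn_add x y) <= sn_norm x + sn_norm y
}.

Arguments sn_zero {s}.
Arguments sn_add {s}.
Arguments sn_opp {s}.
Arguments sn_scal {s}.
Arguments sn_norm {s}.

Fixpoint vsum {E : SeminormedSpace} (n : nat) (f : nat -> E) : E :=
  match n with
  | O => sn_zero
  | S n' => sn_add (vsum n' f) (f n')
  end.

Fixpoint rsum (n : nat) (f : nat -> R) : R :=
  match n with
  | O => 0
  | S n' => rsum n' f + f n'
  end.

Definition is_norm (E : SeminormedSpace) : Prop :=
  forall x : E, sn_norm x = 0 -> x = sn_zero.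

Definition nconverges {E : SeminormedSpace} (u : nat -> E) (l : E) : Prop :=
  forall eps, eps > 0 -> exists N, forall n, (N <= n)%nat ->
    sn_norm (sn_add (u n) (sn_opp l)) < eps.

Definition ncauchy {E : SeminormedSpace} (u : nat -> E) : Prop :=
  forall eps, eps > 0 -> exists N, forall n m, (N <= n)%nat -> (N <= m)%nat ->
    sn_norm (sn_add (u n) (sn_opp (u m))) < eps.

Definition is_banach (X : SeminormedSpace) : Prop :=
  is_norm X /\ forall u : nat -> X, ncauchy u -> exists l, nconverges u l.

Definition expansion {X : SeminormedSpace} (e : nat -> X) (a : nat -> R) (x : X) : Prop :=
  nconverges (fun n => vsum n (fun j => sn_scal (a j) (e j))) x.

Definition schauder_basis {X : SeminormedSpace} (e : nat -> X) : Prop :=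
  (forall x : X, exists a, expansion e a x) /\
  (forall (x : X) a b, expansion e a x -> expansion e b x -> forall n, a n = b n).

Definition supp_below {X : SeminormedSpace} (e : nat -> X) (x : X) (n : nat) : Prop :=
  forall a, expansion e a x -> forall m, (n <= m)%nat -> a m = 0.

Definition supp_above {X : SeminormedSpace} (e : nat -> X) (x : X) (n : nat) : Prop :=
  forall a, expansion e a x -> forall m, (m < n)%nat -> a m = 0.

Definition finitely_supported {X : SeminormedSpace} (e : nat -> X) (x : X) : Prop :=
  exists n, supp_below e x n.

Definition hamel_basis {E : SeminormedSpace} (e : nat -> E) : Prop :=
  (forall (n : nat) (a : nat -> R),
      vsum n (fun j => sn_scal (a j) (e j)) = sn_zero -> forall j, (j < n)%nat -> a j = 0) /\
  (forall v : E, exists (n : nat) (a : nat -> R), v = vsum n (fun j => sn_scal (a j) (e j))).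

Definition equiv_l1 {E : SeminormedSpace} (e : nat -> E) : Prop :=
  exists c C, 0 < c /\ 0 < C /\
    forall (n : nat) (a : nat -> R),
      c * rsum n (fun j => Rabs (a j)) <= sn_norm (vsum n (fun j => sn_scal (a j) (e j))) /\
      sn_norm (vsum n (fun j => sn_scal (a j) (e j))) <= C * rsum n (fun j => Rabs (a j)).

Definition bounded_linear_functional {X : SeminormedSpace} (f : X -> R) : Prop :=
  (forall x y, f (sn_add x y) = f x + f y) /\
  (forall a x, f (sn_scal a x) = a * f x) /\
  (exists C, forall x, Rabs (f x) <= C * sn_norm x).

Definition weak_nbhd {X : SeminormedSpace} (fs : list (X -> R)) (eps : R) (x0 : X) (y : X) : Prop :=
  forall f, In f fs -> Rabs (f y - f x0) < eps.

Definition weak_open {X : SeminormedSpace} (U : X -> Prop) : Prop :=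
  forall x0, U x0 -> exists (fs : list (X -> R)) (eps : R),
    (forall f, In f fs -> bounded_linear_functional f) /\ eps > 0 /\
    (forall y, weak_nbhd fs eps x0 y -> U y).

Definition weak_closure {X : SeminormedSpace} (A : X -> Prop) (x0 : X) : Prop :=
  forall (fs : list (X -> R)) (eps : R),
    (forall f, In f fs -> bounded_linear_functional f) -> eps > 0 ->
    exists y, A y /\ weak_nbhd fs eps x0 y.

Definition weakly_compact {X : SeminormedSpace} (K : X -> Prop) : Prop :=
  forall (I : Type) (U : I -> X -> Prop),
    (forall i, weak_open (U i)) ->
    (forall x, K x -> exists i, U i x) ->
    exists l : list I, forall x, K x -> exists i, In i l /\ U i x.

(* s is an element of [N]^k: a strictly increasing list of length k;
   s(i) (1-based in the paper) is  nth (i-1) s 0  here. *)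
Definition kset (k : nat) (s : list nat) : Prop :=
  length s = k /\ forall i, (i + 1 < k)%nat -> (nth i s 0 < nth (i + 1) s 0)%nat.

(* an infinite subset M of N, given by its increasing enumeration:
   M(l) (1-based in the paper) is  M (l-1)  here *)
Definition infinite_enum (M : nat -> nat) : Prop := forall t, (M t < M (S t))%nat.

Definition in_M (M : nat -> nat) (s : list nat) : Prop :=
  forall n, In n s -> exists t, M t = n.

Definition ksubset_of (M : nat -> nat) (k : nat) (s : list nat) : Prop :=
  kset k s /\ in_M M s.

(* A k-sequence in X: values x s for s in [N]^k (other lists are irrelevant). *)
Definition ksequence (X : Type) := list nat -> X.

Definition plegma_family (M : nat -> nat) (k m : nat) (ss : nat -> list nat) : Prop :=
  (forall j, (j < m)%nat -> ksubset_of M k (ss j)) /\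
  (forall j i, (j + 1 < m)%nat -> (i < k)%nat ->
       (nth i (ss j) 0 < nth i (ss (j + 1)) 0)%nat) /\
  ((1 <= m)%nat -> forall i, (i + 1 < k)%nat ->
       (nth i (ss (m - 1)%nat) 0 < nth (i + 1) (ss 0%nat) 0)%nat).

Definition all_N : nat -> nat := fun t => t.

Definition plegma_pair (k : nat) (s1 s2 : list nat) : Prop :=
  plegma_family all_N k 2 (fun j => match j with O => s1 | _ => s2 end).

Definition generates_spreading_model {X : SeminormedSpace} (k : nat)
    (x : ksequence X) (M : nat -> nat) (E : SeminormedSpace) (e : nat -> E) : Prop :=
  exists delta : nat -> R,
    (forall l, delta l > 0) /\ Un_cv delta 0 /\
    forall (l m : nat) (ss : nat -> list nat) (a : nat -> R),
      (1 <= l)%nat -> (m <= l)%nat ->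
      plegma_family M k m ss ->
      (M (l - 1)%nat <= nth 0 (ss 0%nat) 0)%nat ->
      (forall j, (j < m)%nat -> -1 <= a j <= 1) ->
      Rabs (sn_norm (vsum m (fun j => sn_scal (a j) (x (ss j))))
            - sn_norm (vsum m (fun j => sn_scal (a j) (e j)))) <= delta l.

Definition weakly_rel_compact {X : SeminormedSpace} (k : nat) (x : ksequence X) : Prop :=
  weakly_compact (weak_closure (fun y => exists s, kset k s /\ y = x s)).

Definition in_SM_wrc (X : SeminormedSpace) (k : nat) (E : SeminormedSpace) (e : nat -> E) : Prop :=
  hamel_basis e /\
  exists (x : ksequence X) (M : nat -> nat),
    weakly_rel_compact k x /\ infinite_enum M /\ generates_spreading_model k x M E e.

Definition plegma_block {X : SeminormedSpace} (b : nat -> X) (k : nat) (x : ksequence X) : Prop :=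
  (forall s, kset k s -> finitely_supported b (x s)) /\
  (forall s1 s2, plegma_pair k s1 s2 ->
     exists n, supp_below b (x s1) n /\ supp_above b (x s2) n).

(* Main.v *)
Require Import Defs.
From Stdlib Require Import Reals List Lra Lia ClassicalEpsilon.
From Stdlib Require Import FunctionalExtensionality ProofIrrelevance.
From mathcomp.classical Require filter.
Import ListNotations.
Open Scope R_scope.

(** Fix a free ultrafilter on [nat]. Iterating it over increasing lists of length [m * k] gives a
    limit [rho_y m a] of [\| sum_j a_j y_(s_j) |] along plegma families for every bounded k-sequence
    [y], and [y] generates [rho_y] as a k-spreading model along a suitable infinite set.

    The coordinate functionals of the basis are bounded (Baire), so weak relative compactness
    yields the iterated coordinatewise ultralimits [x_t] of [x] for [length t <= k], and [x_s] is
    the sum of the constant [x_()] and of the differences [y_j(s) = x_(s|j) - x_(s|j-1)],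
    [1 <= j <= k]. If none of these parts dominated the l1 norm, each would admit an l1-normalized
    coefficient vector with small limit. The tensor product of these vectors is small for all parts
    at once, because it groups into spread copies of any one of its factors, and the vector
    [(1/2, -1/2)] kills the constant part. This contradicts the lower l1 estimate for [x]. So some
    [y_j] with [j >= 1] generates an l1 k-spreading model. As [y_j(s)] tends to zero coordinatewise
    in the last element of [s|j], a sliding hump argument makes it plegma block. *)

(* Boundedness gives the upper l1 estimate at once, so the whole effort goes into the lower one.
   Because every limit [rho_y] is taken along the same ultrafilter and without passing to
   subsequences, the limit of [x] can be compared with the limits of its parts at each coefficient
   vector: it is at most their sum. This alone singles out no part, since the part that is large may
   change with the coefficient vector. The tensor product removes this dependence, and it stays
   normalized because the l1 norm is multiplicative on tensors.

   A Schauder basis is given only by existence and uniqueness of expansions, so the continuity of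
   coordinates has to be extracted from completeness. Only coordinates are controlled in the limits:
   weak compactness serves to represent a family of coordinatewise limits by a vector of [X], the
   basis constant bounds that vector, and the sliding hump looks at finitely many coordinates at a
   time. *)
Declare Scope vec_scope.
Delimit Scope vec_scope with V.
Notation "x + y" := (sn_add x y) : vec_scope.
Notation "- x" := (sn_opp x) : vec_scope.
Notation "x - y" := (sn_add x (sn_opp y)) : vec_scope.
Notation "a *: x" := (sn_scal a x%V) (at level 40) : vec_scope.
Notation "\| x |" := (sn_norm x%V) (at level 9, x at level 99, format "\| x |").

(** * Linear identities in a seminormed space *)

Inductive vexp :=
| VAtom (n : nat)
| VZero
| VAdd (e1 e2 : vexp)
| VOpp (e : vexp)
| VScal (a : R) (e : vexp).

Section VectorExpressions.
Variable E : SeminormedSpace.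
Implicit Types (x y z : E) (f g : nat -> E).
Local Open Scope vec_scope.

Lemma add_cancel_l x y z : x + y = x + z -> y = z.
Proof.
  intros H.
  assert (K : forall w, - x + (x + w) = w).
  { intros w. rewrite sn_add_assoc, (sn_add_comm _ (- x) x), sn_add_opp, sn_add_comm.
    apply sn_add_zero. }
  now rewrite <- (K y), <- (K z), H.
Qed.

Lemma scal_zero_l x : 0 *: x = sn_zero.
Proof.
  apply (add_cancel_l (0 *: x)). rewrite <- sn_scal_distr_r, sn_add_zero.
  now rewrite Rplus_0_r.
Qed.

Lemma scal_zero_r a : a *: (sn_zero : E) = sn_zero.
Proof.
  rewrite <- (scal_zero_l sn_zero), sn_scal_assoc. now rewrite Rmult_0_r.
Qed.

Lemma opp_scal x : - x = (-1) *: x.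
Proof.
  apply (add_cancel_l x). rewrite sn_add_opp.
  rewrite <- (sn_scal_one _ x) at 1. rewrite <- sn_scal_distr_r.
  replace (1 + -1)%R with 0%R by ring. now rewrite scal_zero_l.
Qed.

Lemma add_swap x y z (w : E) : (x + y) + (z + w) = (x + z) + (y + w).
Proof.
  rewrite <- !sn_add_assoc. f_equal. rewrite !sn_add_assoc. f_equal. apply sn_add_comm.
Qed.

Lemma vsum_ext n f g : (forall i, (i < n)%nat -> f i = g i) -> vsum n f = vsum n g.
Proof.
  induction n as [|n IH]; intros H; [easy|]. cbn. rewrite IH, H by auto. easy.
Qed.

Lemma vsum_zero n f : (forall i, (i < n)%nat -> f i = sn_zero) -> vsum n f = sn_zero.
Proof.
  induction n as [|n IH]; intros H; [easy|]. cbn. rewrite IH, H by auto. apply sn_add_zero.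
Qed.

Lemma vsum_add n f g : vsum n (fun i => f i + g i) = vsum n f + vsum n g.
Proof.
  induction n as [|n IH]; cbn; [now rewrite sn_add_zero|]. rewrite IH. apply add_swap.
Qed.

Lemma vsum_scal n a f : vsum n (fun i => a *: f i) = a *: vsum n f.
Proof.
  induction n as [|n IH]; cbn; [now rewrite scal_zero_r|]. now rewrite IH, sn_scal_distr_l.
Qed.

Fixpoint veval (env : list E) (e : vexp) : E :=
  match e with
  | VAtom n => nth n env sn_zero
  | VZero => sn_zero
  | VAdd e1 e2 => veval env e1 + veval env e2
  | VOpp e1 => - veval env e1
  | VScal a e1 => a *: veval env e1
  end.

Fixpoint vcoef (e : vexp) (i : nat) : R :=
  match e with
  | VAtom n => if Nat.eqb n i then 1 else 0
  | VZero => 0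
  | VAdd e1 e2 => vcoef e1 i + vcoef e2 i
  | VOpp e1 => - vcoef e1 i
  | VScal a e1 => a * vcoef e1 i
  end.

Lemma vsum_delta n m f :
  vsum n (fun i => (if Nat.eqb m i then 1 else 0) *: f i)
  = if Nat.ltb m n then f m else sn_zero.
Proof.
  induction n as [|n IH]; cbn [vsum]; [easy|]. rewrite IH.
  destruct (Nat.eqb_spec m n) as [->|Hn].
  - rewrite sn_scal_one. destruct (Nat.ltb_spec n n); [lia|].
    destruct (Nat.ltb_spec n (S n)); [|lia]. now rewrite sn_add_comm, sn_add_zero.
  - rewrite scal_zero_l, sn_add_zero.
    destruct (Nat.ltb_spec m n), (Nat.ltb_spec m (S n)); try lia; easy.
Qed.

Lemma veval_coef env e :
  veval env e = vsum (length env) (fun i => vcoef e i *: nth i env sn_zero).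
Proof.
  induction e as [m| |e1 IH1 e2 IH2|e1 IH1|a e1 IH1]; cbn.
  - rewrite vsum_delta. destruct (Nat.ltb_spec m (length env)); [easy|].
    now rewrite nth_overflow.
  - symmetry. apply vsum_zero. intros. apply scal_zero_l.
  - rewrite IH1, IH2, <- vsum_add. apply vsum_ext. intros. now rewrite sn_scal_distr_r.
  - rewrite IH1, opp_scal, <- vsum_scal. apply vsum_ext. intros.
    rewrite sn_scal_assoc. f_equal. ring.
  - rewrite IH1, <- vsum_scal. apply vsum_ext. intros. now rewrite sn_scal_assoc.
Qed.

(** A conjunction of real equations rather than a boolean test: equality of real coefficients does
    not compute, so each equation is left to [field] or [lra]. *)
Fixpoint vcheck (n : nat) (e1 e2 : vexp) : Prop :=
  match n with
  | O => True
  | S n' => vcoef e1 n' = vcoef e2 n' /\ vcheck n' e1 e2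
  end.

Lemma veval_eq env e1 e2 : vcheck (length env) e1 e2 -> veval env e1 = veval env e2.
Proof.
  intros H. rewrite !veval_coef. apply vsum_ext.
  induction (length env) as [|n IH]; intros i Hi; [lia|]. destruct H as [H1 H2].
  destruct (Nat.eq_dec i n) as [->|]; [now rewrite H1|]. apply IH; [easy|lia].
Qed.

End VectorExpressions.

Ltac vlookup x env :=
  match env with
  | cons x _ => constr:(O)
  | cons _ ?r => let n := vlookup x r in constr:(S n)
  end.

Ltac vinsert x env :=
  match env with
  | context [cons x _] => env
  | _ => constr:(cons x env)
  end.

Ltac vatoms env t :=
  match t with
  | sn_zero => env
  | sn_add ?a ?b => let env1 := vatoms env a in vatoms env1 b
  | sn_opp ?a => vatoms env a
  | sn_scal _ ?a => vatoms env a
  | _ => vinsert t env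
  end.

Ltac vreify env t :=
  match t with
  | sn_zero => constr:(VZero)
  | sn_add ?a ?b =>
      let ea := vreify env a in let eb := vreify env b in constr:(VAdd ea eb)
  | sn_opp ?a => let ea := vreify env a in constr:(VOpp ea)
  | sn_scal ?r ?a => let ea := vreify env a in constr:(VScal r ea)
  | _ => let n := vlookup t env in constr:(VAtom n)
  end.

(* Linear identities hold as soon as the coefficients of every atom agree. *)
Ltac vec :=
  match goal with
  | |- @eq (sn_car ?E) ?l ?r =>
      let env0 := vatoms (@nil (sn_car E)) l in
      let env := vatoms env0 r in
      let el := vreify env l in
      let er := vreify env r in
      change (veval E env el = veval E env er);
      apply veval_eq;
      cbn [length vcheck vcoef Nat.eqb]; repeat split; try field; try lra
  end.

(** * Finite sums and norms *)

Section Sums.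
Variable E : SeminormedSpace.
Implicit Types (x y z : E) (f g : nat -> E).
Local Open Scope vec_scope.

Lemma norm_zero : \| (sn_zero : E) | = 0.
Proof. rewrite <- (scal_zero_l E sn_zero), sn_norm_homog, Rabs_R0. ring. Qed.

Lemma norm_opp x : \| - x | = \| x |.
Proof. rewrite opp_scal, sn_norm_homog, Rabs_left by lra. ring. Qed.

Lemma norm_nonneg x : 0 <= \| x |.
Proof.
  pose proof (sn_norm_triangle E x (- x)) as H. rewrite sn_add_opp, norm_zero, norm_opp in H. lra.
Qed.

Lemma norm_sub_le x y : \| x - y | <= \| x | + \| y |.
Proof. pose proof (sn_norm_triangle E x (- y)). rewrite norm_opp in H. lra. Qed.

Lemma norm_sub_sym x y : \| x - y | = \| y - x |.
Proof. rewrite <- norm_opp. f_equal. vec. Qed.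

Lemma norm_sub_triangle y x z : \| x - z | <= \| x - y | + \| y - z |.
Proof. replace (x - z) with ((x - y) + (y - z)) by vec. apply sn_norm_triangle. Qed.

Lemma norm_le_sub x y : \| x | <= \| y | + \| x - y |.
Proof.
  replace (\| x |)%R with (\| y + (x - y) |) by (f_equal; vec). apply sn_norm_triangle.
Qed.

Lemma vsum_sub n f g : vsum n f - vsum n g = vsum n (fun i => f i - g i).
Proof.
  induction n as [|n IH]; cbn; [vec|]. rewrite <- IH. vec.
Qed.

Lemma norm_vsum_le n f : \| vsum n f | <= rsum n (fun i => \| f i |).
Proof.
  induction n as [|n IH]; cbn; [rewrite norm_zero; lra|].
  pose proof (sn_norm_triangle E (vsum n f) (f n)). lra.
Qed.

Lemma vsum_split p q f : vsum (p + q)%nat f = vsum p f + vsum q (fun i => f (p + i)%nat).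
Proof.
  induction q as [|q IH]; cbn.
  - now rewrite Nat.add_0_r, sn_add_zero.
  - rewrite Nat.add_succ_r. cbn. rewrite IH. now rewrite <- sn_add_assoc.
Qed.

Lemma vsum_mul m n f :
  vsum (m * n) f = vsum m (fun i => vsum n (fun l => f (i * n + l)%nat)).
Proof.
  induction m as [|m IH]; [easy|]. cbn [vsum]. rewrite <- IH, Nat.mul_succ_l. apply vsum_split.
Qed.

Lemma vsum_exchange m n (f : nat -> nat -> E) :
  vsum m (fun i => vsum n (fun l => f i l)) = vsum n (fun l => vsum m (fun i => f i l)).
Proof.
  induction m as [|m IH]; cbn.
  - symmetry. now apply vsum_zero.
  - now rewrite IH, <- vsum_add.
Qed.

Lemma rsum_ext n (f g : nat -> R) :
  (forall i, (i < n)%nat -> f i = g i) -> rsum n f = rsum n g.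
Proof.
  induction n as [|n IH]; intros H; [easy|]. cbn. rewrite IH, H by auto. easy.
Qed.

Lemma rsum_le n (f g : nat -> R) :
  (forall i, (i < n)%nat -> f i <= g i) -> rsum n f <= rsum n g.
Proof.
  induction n as [|n IH]; intros H; cbn; [lra|].
  apply Rplus_le_compat; auto.
Qed.

Lemma rsum_const n c : rsum n (fun _ => c) = INR n * c.
Proof. induction n as [|n IH]; [cbn; ring|]. rewrite S_INR. cbn. rewrite IH. ring. Qed.

Lemma rsum_scal_r n (f : nat -> R) c : rsum n (fun i => f i * c)%R = (rsum n f * c)%R.
Proof. induction n as [|n IH]; cbn; [ring|]. rewrite IH. ring. Qed.

Lemma rsum_nonneg n (f : nat -> R) : (forall i, (i < n)%nat -> 0 <= f i) -> 0 <= rsum n f.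
Proof.
  intros H. replace 0 with (rsum n (fun _ => 0)) by (rewrite rsum_const; ring).
  now apply rsum_le.
Qed.

Lemma rsum_term_le n (f : nat -> R) j :
  (forall i, (i < n)%nat -> 0 <= f i) -> (j < n)%nat -> f j <= rsum n f.
Proof.
  induction n as [|n IH]; intros H Hj; [lia|]. cbn.
  destruct (Nat.eq_dec j n) as [->|].
  - pose proof (rsum_nonneg n f). assert (0 <= rsum n f) by auto. lra.
  - assert (f j <= rsum n f) by (apply IH; auto; lia). pose proof (H n). assert (0 <= f n) by auto. lra.
Qed.

Lemma rsum_split p q (f : nat -> R) :
  rsum (p + q)%nat f = (rsum p f + rsum q (fun i => f (p + i)%nat))%R.
Proof.
  induction q as [|q IH]; cbn.
  - rewrite Nat.add_0_r. ring.
  - rewrite Nat.add_succ_r. cbn. rewrite IH. ring.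
Qed.

Lemma rsum_mul m n (f : nat -> R) :
  rsum (m * n) f = rsum m (fun i => rsum n (fun l => f (i * n + l)%nat)).
Proof.
  induction m as [|m IH]; [easy|]. cbn [rsum]. rewrite <- IH, Nat.mul_succ_l. apply rsum_split.
Qed.

Lemma norm_lincomb_le n (a : nat -> R) f B :
  (forall i, (i < n)%nat -> \| f i | <= B) ->
  \| vsum n (fun i => a i *: f i) | <= rsum n (fun i => Rabs (a i)) * B.
Proof.
  intros H. eapply Rle_trans; [apply norm_vsum_le|]. rewrite <- rsum_scal_r.
  apply rsum_le. intros i Hi. rewrite sn_norm_homog.
  apply Rmult_le_compat_l; [apply Rabs_pos|auto].
Qed.

End Sums.

Lemma Rabs_le_inv x B : Rabs x <= B -> - B <= x <= B.
Proof. unfold Rabs. destruct Rcase_abs; lra. Qed.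

Lemma rinv_small eps : 0 < eps -> exists N, forall n, (N <= n)%nat -> / INR (S n) < eps.
Proof.
  intros H. destruct (archimed_cor1 eps H) as [N [H1 H2]]. exists N. intros n Hn.
  eapply Rle_lt_trans; [|exact H1]. apply Rinv_le_contravar.
  - apply lt_0_INR; lia.
  - apply le_INR; lia.
Qed.

Lemma inv_INR_pos n : 0 < / INR (S n).
Proof. apply Rinv_0_lt_compat, lt_0_INR. lia. Qed.

(** * Ultrafilters and iterated ultrafilter quantifiers *)

(** Stated over any type because the iterated quantifiers are ultrafilters on lists. Freeness is
    kept apart: the zero-fold iteration is principal. *)
Record ultra {T : Type} (Q : (T -> Prop) -> Prop) : Prop := {
  ultra_mono : forall P P' : T -> Prop, (forall t, P t -> P' t) -> Q P -> Q P';
  ultra_and : forall P P' : T -> Prop, Q P -> Q P' -> Q (fun t => P t /\ P' t);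
  ultra_em : forall P : T -> Prop, Q P \/ Q (fun t => ~ P t);
  ultra_proper : ~ Q (fun _ => False)
}.

Section Ultra.
Context {T : Type} {Q : (T -> Prop) -> Prop} (HQ : ultra Q).

Lemma ultra_all (P : T -> Prop) : (forall t, P t) -> Q P.
Proof.
  intros H. destruct (ultra_em Q HQ P) as [K|K]; [easy|].
  exfalso. apply (ultra_proper Q HQ). revert K. apply ultra_mono; [easy|].
  intros t Ht. now apply Ht.
Qed.

Lemma ultra_ex (P : T -> Prop) : Q P -> exists t, P t.
Proof.
  intros H. apply NNPP. intros K. apply (ultra_proper Q HQ). revert H.
  apply ultra_mono; [easy|]. intros t Ht. apply K. now exists t.
Qed.

Lemma ultra_forall_list {A} (L : list A) (P : A -> T -> Prop) :
  (forall x, In x L -> Q (P x)) -> Q (fun t => forall x, In x L -> P x t).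
Proof.
  induction L as [|a L IH]; intros H.
  - apply ultra_all. intros t x [].
  - assert (H1 : Q (P a)) by (apply H; now left).
    assert (H2 : Q (fun t => forall x, In x L -> P x t)) by (apply IH; intros; apply H; now right).
    generalize (ultra_and Q HQ _ _ H1 H2). apply ultra_mono; [easy|].
    intros t [K1 K2] x [<-|Hx]; auto.
Qed.

Lemma ultra_forall_lt n (P : nat -> T -> Prop) :
  (forall i, (i < n)%nat -> Q (P i)) -> Q (fun t => forall i, (i < n)%nat -> P i t).
Proof.
  intros H. assert (K : Q (fun t => forall i, In i (seq 0 n) -> P i t)).
  { apply ultra_forall_list. intros i Hi. apply H. apply in_seq in Hi. lia. }
  revert K. apply ultra_mono; [easy|]. intros t Ht i Hi. apply Ht. apply in_seq. lia.
Qed.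

Lemma ultra_imp (A : Prop) (P : T -> Prop) : (A -> Q P) -> Q (fun t => A -> P t).
Proof.
  intros H. destruct (classic A) as [a|na].
  - generalize (H a). apply ultra_mono; [easy|]. auto.
  - apply ultra_all. easy.
Qed.

Definition qlim (f : T -> R) (L : R) : Prop :=
  forall eps, 0 < eps -> Q (fun t => Rabs (f t - L) < eps).

(** The limit is the supremum of the [r] that [f] exceeds for [Q]-many [t]; above it [ultra_em]
    turns failure into an upper bound for [f]. *)
Lemma qlim_exists f B : (forall t, Rabs (f t) <= B) -> exists L, qlim f L.
Proof.
  intros HB.
  destruct (completeness (fun r => Q (fun t => r <= f t))) as [L [HL1 HL2]].
  - exists B. intros r Hr. apply ultra_ex in Hr. destruct Hr as [t Ht].
    specialize (HB t). apply Rabs_le_inv in HB. lra.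
  - exists (- B). apply ultra_all. intros t. specialize (HB t). apply Rabs_le_inv in HB. lra.
  - exists L. intros eps Heps.
    assert (H1 : Q (fun t => ~ L + eps / 2 <= f t)).
    { destruct (ultra_em Q HQ (fun t => L + eps / 2 <= f t)) as [K|K]; [|easy].
      apply HL1 in K. lra. }
    assert (H2 : exists r, L - eps < r /\ Q (fun t => r <= f t)).
    { apply NNPP. intros K. assert (L <= L - eps); [|lra]. apply HL2. intros r Hr.
      destruct (Rle_dec r (L - eps)); [easy|]. exfalso. apply K. exists r. split; [lra|easy]. }
    destruct H2 as [r [Hr1 Hr2]].
    generalize (ultra_and Q HQ _ _ H1 Hr2). apply ultra_mono; [easy|].
    intros t [K1 K2]. apply Rabs_def1; lra.
Qed.

Lemma qlim_le f g L L' : qlim f L -> qlim g L' -> Q (fun t => f t <= g t) -> L <= L'.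
Proof.
  intros Hf Hg H. apply Rnot_lt_le. intros K.
  generalize (ultra_and Q HQ _ _ H
    (ultra_and Q HQ _ _ (Hf ((L - L') / 2) ltac:(lra)) (Hg ((L - L') / 2) ltac:(lra)))).
  intros HH. apply ultra_ex in HH. destruct HH as [t [K1 [K2 K3]]].
  apply Rabs_def2 in K2, K3. lra.
Qed.

Lemma qlim_const c : qlim (fun _ => c) c.
Proof.
  intros eps Heps. apply ultra_all. intros t. now rewrite Rminus_diag, Rabs_R0.
Qed.

Lemma qlim_plus f g L L' : qlim f L -> qlim g L' -> qlim (fun t => f t + g t) (L + L').
Proof.
  intros Hf Hg eps Heps.
  generalize (ultra_and Q HQ _ _ (Hf (eps / 2) ltac:(lra)) (Hg (eps / 2) ltac:(lra))).
  apply ultra_mono; [easy|]. intros t [H1 H2].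
  apply Rabs_def2 in H1, H2. apply Rabs_def1; lra.
Qed.

Lemma qlim_scal c f L : qlim f L -> qlim (fun t => c * f t) (c * L).
Proof.
  intros Hf eps Heps. assert (0 < Rabs c + 1) by (pose proof (Rabs_pos c); lra).
  assert (K : 0 < eps / (Rabs c + 1)) by now apply Rdiv_lt_0_compat.
  generalize (Hf _ K). apply ultra_mono; [easy|]. intros t Ht.
  rewrite <- Rmult_minus_distr_l, Rabs_mult.
  apply Rle_lt_trans with ((Rabs c + 1) * Rabs (f t - L)).
  - pose proof (Rabs_pos (f t - L)). nra.
  - apply (Rmult_lt_compat_l (Rabs c + 1)) in Ht; [|easy].
    replace ((Rabs c + 1) * (eps / (Rabs c + 1))) with eps in Ht by (field; lra). easy.
Qed.

Lemma qlim_ext f g L : (forall t, f t = g t) -> qlim f L -> qlim g L.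
Proof.
  intros H Hf eps Heps. generalize (Hf eps Heps). apply ultra_mono; [easy|].
  intros t. now rewrite H.
Qed.

Lemma qlim_unique f L L' : qlim f L -> qlim f L' -> L = L'.
Proof.
  intros H H'. apply Rle_antisym; eapply qlim_le; eauto; apply ultra_all; intros; lra.
Qed.

End Ultra.

Arguments qlim {T} Q f L.

(** The ultrafilter lemma, applied to the filter of sets that contain a tail of the natural
    numbers. *)
Lemma free_ultrafilter :
  exists U : (nat -> Prop) -> Prop, ultra U /\ forall n, U (fun i => (n < i)%nat).
Proof.
  set (F := fun P : nat -> Prop => exists n, forall i, (n < i)%nat -> P i).
  assert (HF : filter.ProperFilter F).
  { split.
    - intros [n Hn]. apply (Hn (S n)). lia.
    - split.
      + now exists O.
      + intros A B [n Hn] [m Hm]. exists (Nat.max n m). intros i Hi. split.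
        * apply Hn. lia.
        * apply Hm. lia.
      + intros P P' H [n Hn]. exists n. intros i Hi. apply H, Hn, Hi. }
  destruct (filter.ultraFilterLemma HF) as [U [HU HFU]].
  exists U. split.
  - destruct (filter.ultra_proper (F := U)) as [H0 [HT HI HS]]. split.
    + exact HS.
    + exact HI.
    + intros P. apply filter.in_ultra_setVsetC; assumption.
    + exact H0.
  - intros n. apply HFU. now exists n.
Qed.

(** The [n]-fold Fubini power of [U], started at the prefix [t]. The outermost quantifier binds the
    first new entry, so each entry ranges over a large set that depends on all earlier ones. *)
Fixpoint iter_q (U : (nat -> Prop) -> Prop) (n : nat) (P : list nat -> Prop) (t : list nat)
  : Prop :=
  match n with
  | O => P t
  | S n' => U (fun i => iter_q U n' P (t ++ [i]))
  end.

Section IteratedQuantifier.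
Variable U : (nat -> Prop) -> Prop.
Hypothesis HU : ultra U.
Hypothesis U_free : forall n, U (fun i => (n < i)%nat).

Lemma iter_q_ultra n t : ultra (fun P => iter_q U n P t).
Proof.
  revert t. induction n as [|n IH]; intros t; cbn.
  - split; auto. intros P. apply classic.
  - split.
    + intros P P' H. apply ultra_mono; [easy|]. intros i. now apply (ultra_mono _ (IH _)).
    + intros P P' H H'. generalize (ultra_and _ HU _ _ H H'). apply ultra_mono; [easy|].
      intros i [K K']. now apply (ultra_and _ (IH _)).
    + intros P. destruct (ultra_em _ HU (fun i => iter_q U n P (t ++ [i]))) as [H|H]; [now left|].
      right. revert H. apply ultra_mono; [easy|]. intros i Hi.
      destruct (ultra_em _ (IH (t ++ [i])) P); easy.
    + intros H. apply ultra_ex in H; [|easy]. destruct H as [i Hi].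
      now apply (ultra_proper _ (IH (t ++ [i]))).
Qed.

Lemma ultra_above (F : list nat) : U (fun i => forall v, In v F -> (v < i)%nat).
Proof. apply ultra_forall_list; [easy|]. intros; apply U_free. Qed.

Lemma kset_snoc n t i :
  kset n t -> (forall v, In v t -> (v < i)%nat) -> kset (S n) (t ++ [i]).
Proof.
  intros [H1 H2] Hi. split; [rewrite length_app; cbn; lia|].
  intros j Hj. destruct (Nat.lt_ge_cases (j + 1) n) as [K|K].
  - rewrite !app_nth1 by lia. auto.
  - rewrite app_nth1 by lia. rewrite app_nth2 by lia.
    replace (j + 1 - length t)%nat with O by lia. cbn. apply Hi, nth_In. lia.
Qed.

Lemma iter_q_kset n N : iter_q U n (fun s => kset n s /\ forall v, In v s -> (N <= v)%nat) [].
Proof.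
  enough (K : forall n j t, kset j t -> (forall v, In v t -> (N <= v)%nat) ->
     iter_q U n (fun s => kset (j + n) s /\ forall v, In v s -> (N <= v)%nat) t).
  { apply (K n O); [|easy]. split; [easy|]. lia. }
  clear n. induction n as [|n IH]; intros j t H1 H2.
  - cbn. now rewrite Nat.add_0_r.
  - cbn. generalize (ultra_above (N :: t)). apply ultra_mono; [easy|]. intros i Hi.
    rewrite Nat.add_succ_r. apply (IH (S j)).
    + apply kset_snoc; [easy|]. intros v Hv. apply Hi. now right.
    + intros v Hv. apply in_app_or in Hv. destruct Hv as [Hv|[<-|[]]]; [auto|].
      assert (N < i)%nat by (apply Hi; now left). lia.
Qed.

(** A diagonal choice: each [M p] is picked from the large set attached to the finite history, and
    freeness places it above that history. *)
Lemma ultra_select (G : list nat -> nat -> Prop) :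
  (forall F, U (G F)) ->
  exists M, infinite_enum M /\ forall p, G (map M (seq 0 p)) (M p).
Proof.
  intros HG.
  assert (K : forall F, exists i, G F i /\ forall v, In v F -> (v < i)%nat).
  { intros F. apply (ultra_ex HU). apply ultra_and; auto. apply ultra_above. }
  set (pick := fun F => proj1_sig (constructive_indefinite_description _ (K F))).
  assert (Hpick : forall F, G F (pick F) /\ forall v, In v F -> (v < pick F)%nat).
  { intros F. unfold pick. now destruct constructive_indefinite_description. }
  set (hist := fix hist p := match p with O => [] | S q => hist q ++ [pick (hist q)] end).
  set (M := fun p => pick (hist p)).
  assert (Hh : forall p, hist p = map M (seq 0 p)).
  { induction p as [|p IH]; [easy|]. rewrite seq_S, map_app, <- IH. easy. }
  exists M. split.
  - intros t. unfold M at 2. apply Hpick. cbn. apply in_or_app. right. now left.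
  - intros p. rewrite <- Hh. apply Hpick.
Qed.

Lemma lists_over_finite (F : list nat) n :
  exists L : list (list nat), forall t, incl t F -> (length t <= n)%nat -> In t L.
Proof.
  induction n as [|n [L HL]].
  - exists [[]]. intros [|x t] _ H; cbn in H; [now left|lia].
  - exists ([] :: flat_map (fun t => map (fun x => x :: t) F) L). intros [|x t] Ht Hl; [now left|].
    right. apply in_flat_map. exists t. split.
    + apply HL; [|cbn in Hl; lia]. intros y Hy. apply Ht. now right.
    + apply in_map_iff. exists x. split; [easy|]. apply Ht. now left.
Qed.

Lemma kset_nth_lt n s i j : kset n s -> (i < j < n)%nat -> (nth i s 0 < nth j s 0)%nat.
Proof.
  intros [H1 H2] [Hij Hj]. induction j as [|j IH]; [lia|].
  assert (nth j s 0 < nth (S j) s 0)%nat.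
  { replace (S j) with (j + 1)%nat by lia. apply H2. lia. }
  destruct (Nat.eq_dec i j) as [->|]; [easy|]. assert (nth i s 0 < nth j s 0)%nat by (apply IH; lia).
  lia.
Qed.

Lemma firstn_snoc {A} (d : A) r s :
  (r < length s)%nat -> firstn (S r) s = firstn r s ++ [nth r s d].
Proof.
  revert s. induction r as [|r IH]; intros [|x s] H; cbn in H; try lia; [easy|].
  cbn [firstn nth app]. rewrite <- IH by lia. easy.
Qed.

(** Choosing [i] after the history [F] must not spoil any property still pending on a prefix drawn
    from [F]. The bound on [l] by the length of [F] leaves finitely many demands, hence a large set
    of good [i]; it is also the source of the condition [l <= v] in [ultra_ramsey]. *)
Definition iter_good (N : nat -> nat) (P : nat -> nat -> list nat -> Prop)
    (F : list nat) (i : nat) : Prop :=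
  forall l, (l < S (length F))%nat -> forall m, (m < S l)%nat ->
  forall t, incl t F -> forall r, N m = (S r + length t)%nat ->
  iter_q U (S r) (P l m) t -> iter_q U r (P l m) (t ++ [i]).

Lemma iter_good_large N P F : U (iter_good N P F).
Proof.
  apply ultra_forall_lt; [easy|]. intros l Hl. apply ultra_forall_lt; [easy|]. intros m Hm.
  destruct (lists_over_finite F (N m)) as [L HL].
  assert (K : U (fun i => forall t, In t L -> forall r, (r < N m)%nat ->
      iter_q U (S r) (P l m) t -> iter_q U r (P l m) (t ++ [i]))).
  { apply ultra_forall_list; [easy|]. intros t _. apply ultra_forall_lt; [easy|]. intros r _.
    apply ultra_imp; [easy|]. now cbn. }
  revert K. apply ultra_mono; [easy|]. intros i Hi t Ht r Hr. apply Hi; [|lia].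
  apply HL; [easy|lia].
Qed.

(* Ramsey's theorem for countably many properties, read off the ultrafilter: a property that holds
   for iterated-ultrafilter-many increasing lists holds for all increasing lists from [M]. The
   hypothesis [G] threads further requirements through the construction of [M]. *)
Lemma ultra_ramsey (N : nat -> nat) (P : nat -> nat -> list nat -> Prop)
    (G : list nat -> nat -> Prop) :
  (forall l m, (m <= l)%nat -> iter_q U (N m) (P l m) []) ->
  (forall F, U (G F)) ->
  exists M, infinite_enum M /\ (forall p, G (map M (seq 0 p)) (M p)) /\
    forall l m s, (m <= l)%nat -> kset (N m) s -> (forall v, In v s -> (l <= v)%nat) ->
      P l m (map M s).
Proof.
  intros HP HG.
  destruct (ultra_select (fun F i => G F i /\ iter_good N P F i)) as [M [HM1 HM2]].
  { intros F. apply ultra_and; auto. apply iter_good_large. }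
  exists M. split; [easy|]. split; [apply HM2|].
  intros l m s Hm Hs Hl. pose proof Hs as [Hlen _].
  (* With [r] entries of [s] consumed, [r'] quantifiers remain; at [r' = 0] nothing but the property
     of [map M s] is left. *)
  enough (K : forall r r', N m = (r' + r)%nat -> iter_q U r' (P l m) (map M (firstn r s))).
  { specialize (K (N m) O eq_refl). rewrite <- Hlen, firstn_all in K. exact K. }
  induction r as [|r IH]; intros r' Hr.
  - cbn. replace r' with (N m) by lia. now apply HP.
  - rewrite (firstn_snoc O) by lia. rewrite map_app. cbn [map].
    destruct (HM2 (nth r s O)) as [_ HGd].
    assert (Hin : (l <= nth r s 0)%nat) by (apply Hl, nth_In; lia).
    apply (HGd l) ; [rewrite length_map, length_seq; lia|lia| | |].
    + intros v Hv. apply in_map_iff in Hv. destruct Hv as [u [<- Hu]]. apply in_map.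
      apply in_seq. split; [lia|].
      apply (In_nth _ _ O) in Hu. destruct Hu as [i [Hi <-]].
      rewrite length_firstn in Hi. rewrite nth_firstn.
      destruct (Nat.ltb_spec i r); [|lia].
      apply kset_nth_lt with (N m); [easy|lia].
    + rewrite length_map, length_firstn. lia.
    + apply IH. lia.
Qed.

End IteratedQuantifier.

(** * Boundedness of the partial sum projections *)

Definition coord {X : SeminormedSpace} (b : nat -> X) (x : X) : nat -> R :=
  epsilon (inhabits (fun _ => 0)) (fun a => expansion b a x).

Definition psum {X : SeminormedSpace} (b : nat -> X) (n : nat) (x : X) : X :=
  vsum n (fun j => sn_scal (coord b x j) (b j)).

Lemma half_pow_pos K : 0 < (/ 2) ^ K.
Proof. apply pow_lt. lra. Qed.

Lemma half_pow_small c eps :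
  0 < eps -> exists N, forall n, (N <= n)%nat -> c * (/ 2) ^ n < eps.
Proof.
  intros He. set (c' := Rabs c + 1). assert (Hc : 0 < c') by (unfold c'; pose proof (Rabs_pos c); lra).
  destruct (pow_lt_1_zero (/ 2)) with (y := eps / c') as [N HN].
  - rewrite Rabs_right; lra.
  - now apply Rdiv_lt_0_compat.
  - exists N. intros n Hn. specialize (HN n Hn).
    rewrite Rabs_right in HN by (left; apply half_pow_pos).
    apply (Rmult_lt_compat_l c') in HN; [|easy].
    replace (c' * (eps / c')) with eps in HN by (field; lra).
    pose proof (half_pow_pos n). pose proof (Rle_abs c). unfold c' in *. nra.
Qed.

Section Basis.
Variable X : SeminormedSpace.
Variable b : nat -> X.
Hypothesis HX : is_banach X.
Hypothesis Hb : schauder_basis b.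
Implicit Types (x y z u : X).
Local Open Scope vec_scope.

Lemma coord_spec x : expansion b (coord b x) x.
Proof. unfold coord. apply epsilon_spec, Hb. Qed.

Lemma coord_unique a x : expansion b a x -> forall n, coord b x n = a n.
Proof. intros H. apply (proj2 Hb x); [apply coord_spec|easy]. Qed.

Lemma expansion_add a a' x x' :
  expansion b a x -> expansion b a' x' -> expansion b (fun n => a n + a' n)%R (x + x').
Proof.
  intros H H' eps Heps.
  destruct (H (eps / 2)%R) as [N HN]; [lra|]. destruct (H' (eps / 2)%R) as [N' HN']; [lra|].
  exists (Nat.max N N'). intros n Hn. specialize (HN n ltac:(lia)). specialize (HN' n ltac:(lia)).
  rewrite (vsum_ext _ n _ (fun j => a j *: b j + a' j *: b j)) by (intros; apply sn_scal_distr_r).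
  rewrite vsum_add. set (s := vsum n (fun j => a j *: b j)) in *.
  set (s' := vsum n (fun j => a' j *: b j)) in *.
  replace (s + s' - (x + x')) with ((s - x) + (s' - x')) by vec.
  pose proof (sn_norm_triangle X (s - x) (s' - x')). lra.
Qed.

Lemma expansion_scal c a x : expansion b a x -> expansion b (fun n => c * a n)%R (c *: x).
Proof.
  intros H eps Heps.
  assert (Hc : 0 < Rabs c + 1) by (pose proof (Rabs_pos c); lra).
  destruct (H (eps / (Rabs c + 1))%R) as [N HN]; [now apply Rdiv_lt_0_compat|].
  exists N. intros n Hn. specialize (HN n Hn).
  rewrite (vsum_ext _ n _ (fun j => c *: (a j *: b j))) by (intros; now rewrite sn_scal_assoc).
  rewrite vsum_scal. set (s := vsum n _) in *.
  replace (c *: s - c *: x) with (c *: (s - x)) by vec. rewrite sn_norm_homog.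
  apply (Rmult_lt_compat_l (Rabs c + 1)) in HN; [|easy].
  replace ((Rabs c + 1) * (eps / (Rabs c + 1)))%R with eps in HN by (field; lra).
  pose proof (norm_nonneg X (s - x)). nra.
Qed.

Lemma coord_add x y n : coord b (x + y) n = (coord b x n + coord b y n)%R.
Proof. apply (coord_unique (fun n => coord b x n + coord b y n)%R). apply expansion_add; apply coord_spec. Qed.

Lemma coord_scal c x n : coord b (c *: x) n = (c * coord b x n)%R.
Proof. apply (coord_unique (fun n => c * coord b x n)%R). apply expansion_scal, coord_spec. Qed.

Lemma coord_sub x y n : coord b (x - y) n = (coord b x n - coord b y n)%R.
Proof. rewrite opp_scal, coord_add, coord_scal. ring. Qed.

Lemma expansion_finite (a : nat -> R) n :
  expansion b (fun j => if Nat.ltb j n then a j else 0) (vsum n (fun j => a j *: b j)).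
Proof.
  intros eps Heps. exists n. intros m Hm.
  replace m with (n + (m - n))%nat by lia. rewrite vsum_split.
  rewrite (vsum_zero _ (m - n)).
  - rewrite (vsum_ext _ n _ (fun j => a j *: b j)).
    + set (s := vsum n _). replace (s + sn_zero - s) with (sn_zero : X) by vec.
      now rewrite norm_zero.
    + intros i Hi. now destruct (Nat.ltb_spec i n); [|lia].
  - intros i Hi. destruct (Nat.ltb_spec (n + i) n); [lia|]. apply scal_zero_l.
Qed.

Lemma psum_sub n x y : psum b n (x - y) = psum b n x - psum b n y.
Proof.
  unfold psum. rewrite vsum_sub. apply vsum_ext. intros i Hi. rewrite coord_sub. vec.
Qed.

Lemma psum_add n x y : psum b n (x + y) = psum b n x + psum b n y.
Proof.
  unfold psum. rewrite <- vsum_add. apply vsum_ext. intros i Hi. rewrite coord_add. vec.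
Qed.

Lemma psum_scal n c x : psum b n (c *: x) = c *: psum b n x.
Proof.
  unfold psum. rewrite <- vsum_scal. apply vsum_ext. intros i Hi. rewrite coord_scal. vec.
Qed.

Lemma psum_zero n : psum b n sn_zero = sn_zero.
Proof.
  replace (sn_zero : X) with (0 *: (sn_zero : X)) by vec. rewrite psum_scal. vec.
Qed.

(** If [b j] vanished, the [j]-th unit sequence would be a second expansion of zero. *)
Lemma basis_norm_pos j : 0 < \| b j |.
Proof.
  destruct (norm_nonneg X (b j)) as [H|H]; [easy|]. exfalso.
  symmetry in H. apply (proj1 HX) in H.
  assert (K : expansion b (fun i => if Nat.eqb j i then 1 else 0) sn_zero).
  { intros eps Heps. exists O. intros n _. rewrite vsum_delta.
    replace (if Nat.ltb j n then b j else sn_zero) with (sn_zero : X)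
      by (destruct (Nat.ltb j n); congruence).
    replace (sn_zero - sn_zero) with (sn_zero : X) by vec. now rewrite norm_zero. }
  pose proof (coord_unique _ _ K j) as K1. cbn beta in K1. rewrite Nat.eqb_refl in K1.
  replace (sn_zero : X) with (0 *: (sn_zero : X)) in K1 by vec. rewrite coord_scal in K1. lra.
Qed.

Lemma psum_bounded x : exists B, forall n, \| psum b n x | <= B.
Proof.
  destruct (coord_spec x 1) as [N HN]; [lra|].
  exists (\| x | + 1 + rsum N (fun i => \| psum b i x |))%R. intros n.
  assert (K : 0 <= rsum N (fun i => \| psum b i x |)) by (apply rsum_nonneg; intros; apply norm_nonneg).
  destruct (Nat.lt_ge_cases n N) as [H|H].
  - pose proof (rsum_term_le N (fun i => \| psum b i x |) n ltac:(intros; apply norm_nonneg) H).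
    cbn beta in *. pose proof (norm_nonneg X x). lra.
  - specialize (HN n H). fold (psum b n x) in HN. pose proof (norm_le_sub X (psum b n x) x). lra.
Qed.

(** * Baire category and the basis constant *)

Definition pbound (C : R) x : Prop := forall n, \| psum b n x | <= C.

(** The sets [pbound (INR N)] cover [X] by [psum_bounded], so by Baire's argument one of them is
    dense in a ball. Otherwise nested balls with radii at least halved at each step would avoid them
    one after the other, and the common point would have unbounded partial sums. *)
Lemma baire_pbound : exists (N : nat) x0 r, 0 < r /\
  forall y, \| y - x0 | < r -> forall eps, 0 < eps -> exists u, pbound (INR N) u /\ \| u - y | < eps.
Proof.
  apply NNPP. intros H.
  (* The premise on the radius stands inside the existential, so that choice yields a total [step];
     [Hr] discharges it along the iteration. *)
  assert (Hstep : forall (N : nat) (p : X * R), exists q : X * R, 0 < snd p ->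
    0 < snd q <= snd p / 2 /\
    forall u, \| u - fst q | <= snd q -> \| u - fst p | <= snd p /\ ~ pbound (INR N) u).
  { intros N [x r]. cbn. destruct (Rlt_dec 0 r) as [Hr|Hr]; [|now exists (x, r)].
    apply NNPP. intros K. apply H. exists N, x, r. split; [easy|]. intros y Hy eps Heps.
    apply NNPP. intros K2. apply K.
    set (r' := (Rmin (eps / 2) ((r - \| y - x |) / 2))%R).
    assert (0 < r') by (apply Rmin_pos; lra).
    assert (r' <= eps / 2) by apply Rmin_l.
    assert (r' <= (r - \| y - x |) / 2) by apply Rmin_r.
    pose proof (norm_nonneg X (y - x)).
    exists (y, r'). intros _. cbn. split; [lra|]. intros u Hu. split.
    - pose proof (norm_sub_triangle X y u x). lra.
    - intros Hp. apply K2. exists u. split; [easy|lra]. }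
  set (step := fun N p => proj1_sig (constructive_indefinite_description _ (Hstep N p))).
  set (p := fix p n := match n with O => (sn_zero : X, 1) | S m => step m (p m) end).
  assert (Hp : forall n, 0 < snd (p n) ->
    0 < snd (p (S n)) <= snd (p n) / 2 /\
    forall u, \| u - fst (p (S n)) | <= snd (p (S n)) ->
      \| u - fst (p n) | <= snd (p n) /\ ~ pbound (INR n) u).
  { intros n. cbn. unfold step. now destruct constructive_indefinite_description. }
  clearbody step.
  assert (Hr : forall n, 0 < snd (p n) <= (/ 2) ^ n).
  { induction n as [|n IH]; [cbn; lra|]. destruct (Hp n) as [K _]; [lra|].
    change ((/ 2) ^ S n)%R with (/ 2 * (/ 2) ^ n)%R. lra. }
  assert (Hnest : forall n d u, \| u - fst (p (n + d)%nat) | <= snd (p (n + d)%nat) ->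
    \| u - fst (p n) | <= snd (p n)).
  { intros n. induction d as [|d IH]; intros u Hu.
    - now rewrite Nat.add_0_r in Hu.
    - rewrite Nat.add_succ_r in Hu. apply IH. apply Hp; [apply Hr|easy]. }
  assert (Hself : forall n, \| fst (p n) - fst (p n) | = 0).
  { intros n. replace (fst (p n) - fst (p n)) with (sn_zero : X) by vec. apply norm_zero. }
  assert (Hd : forall n m, (n <= m)%nat -> \| fst (p m) - fst (p n) | <= (/ 2) ^ n).
  { intros n m Hnm. apply Rle_trans with (snd (p n)); [|apply Hr].
    apply Hnest with (m - n)%nat. replace (n + (m - n))%nat with m by lia.
    rewrite Hself. left. apply Hr. }
  destruct (proj2 HX (fun n => fst (p n))) as [x Hx].
  { intros eps Heps. destruct (half_pow_small 2 eps Heps) as [N HN]. exists N.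
    intros n m Hn Hm. pose proof (Hd N n Hn). pose proof (Hd N m Hm).
    specialize (HN N (Nat.le_refl N)).
    pose proof (norm_sub_triangle X (fst (p N)) (fst (p n)) (fst (p m))) as K.
    rewrite (norm_sub_sym X (fst (p N)) (fst (p m))) in K. lra. }
  assert (Hxn : forall n, \| x - fst (p n) | <= snd (p n)).
  { intros n. apply Rle_plus_epsilon. intros eps Heps. destruct (Hx eps Heps) as [N HN].
    specialize (HN (Nat.max n N) ltac:(lia)).
    assert (\| fst (p (Nat.max n N)) - fst (p n) | <= snd (p n)).
    { apply Hnest with (Nat.max n N - n)%nat.
      replace (n + (Nat.max n N - n))%nat with (Nat.max n N) by lia. rewrite Hself. left. apply Hr. }
    pose proof (norm_sub_triangle X (fst (p (Nat.max n N))) x (fst (p n))) as K.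
    rewrite (norm_sub_sym X x (fst (p (Nat.max n N)))) in K. cbn beta in HN. lra. }
  destruct (psum_bounded x) as [B HB].
  destruct (INR_unbounded B) as [N HN].
  destruct (Hp N) as [_ K]; [apply Hr|]. apply (K x (Hxn (S N))).
  intros n. specialize (HB n). lra.
Qed.

(** Half the difference of approximants of [x0 + y'] and [x0 - y'] approximates [y']: the centre
    cancels, and the ball of [baire_pbound] moves to the origin. Scaling by [t] gives all radii. *)
Lemma pbound_dense : exists C r, 0 < C /\ 0 < r /\
  forall t y, 0 < t -> \| y | < t * r -> forall eps, 0 < eps ->
    exists u, pbound (t * C) u /\ \| u - y | < eps.
Proof.
  destruct baire_pbound as [N [x0 [r [Hr H]]]]. exists (INR N + 1)%R, r.
  pose proof (pos_INR N). split; [lra|]. split; [easy|].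
  intros t y Ht Hy eps Heps.
  set (y' := / t *: y).
  assert (Hy' : \| y' | < r).
  { unfold y'. rewrite sn_norm_homog, Rabs_right by (left; now apply Rinv_0_lt_compat).
    apply (Rmult_lt_reg_l t); [easy|]. rewrite <- Rmult_assoc, Rinv_r by lra. lra. }
  assert (He : 0 < eps / t) by now apply Rdiv_lt_0_compat.
  destruct (H (x0 + y')) with (eps := (eps / t)%R) as [u1 [Hu1 Hu1']]; [|easy|].
  { now replace (x0 + y' - x0) with y' by vec. }
  destruct (H (x0 - y')) with (eps := (eps / t)%R) as [u2 [Hu2 Hu2']]; [|easy|].
  { replace (x0 - y' - x0) with (- y') by vec. now rewrite norm_opp. }
  exists ((t / 2) *: (u1 - u2)). split.
  - intros n. rewrite psum_scal, psum_sub, sn_norm_homog, Rabs_right by lra.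
    pose proof (norm_sub_le X (psum b n u1) (psum b n u2)). specialize (Hu1 n). specialize (Hu2 n). nra.
  - replace ((t / 2) *: (u1 - u2) - y)
      with ((t / 2) *: ((u1 - (x0 + y')) - (u2 - (x0 - y')))) by (unfold y'; vec; lra).
    rewrite sn_norm_homog, Rabs_right by lra.
    pose proof (norm_sub_le X (u1 - (x0 + y')) (u2 - (x0 - y'))).
    apply Rle_lt_trans with (t / 2 * (\| u1 - (x0 + y') | + \| u2 - (x0 - y') |))%R.
    { apply Rmult_le_compat_l; lra. }
    replace eps with (t / 2 * (eps / t + eps / t))%R by (field; lra).
    apply Rmult_lt_compat_l; lra.
Qed.

Lemma norm_coord_le x j C : pbound C x -> Rabs (coord b x j) * \| b j | <= 2 * C.
Proof.
  intros H. rewrite <- sn_norm_homog.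
  replace (coord b x j *: b j) with (psum b (S j) x - psum b j x) by (unfold psum; cbn [vsum]; vec).
  pose proof (norm_sub_le X (psum b (S j) x) (psum b j x)). pose proof (H (S j)). pose proof (H j). lra.
Qed.

Lemma lincomb_cv n (c : nat -> nat -> R) (a : nat -> R) :
  (forall j, Un_cv (fun K => c K j) (a j)) ->
  forall eps, 0 < eps -> exists N, forall K, (N <= K)%nat ->
    \| vsum n (fun j => c K j *: b j) - vsum n (fun j => a j *: b j) | < eps.
Proof.
  intros H. induction n as [|n IH]; intros eps Heps; cbn.
  - exists O. intros. replace (sn_zero - sn_zero) with (sn_zero : X) by vec. now rewrite norm_zero.
  - destruct (IH (eps / 2)%R) as [N HN]; [lra|].
    pose proof (basis_norm_pos n) as Hn.
    destruct (H n (eps / 2 / \| b n |)%R) as [N' HN']; [apply Rdiv_lt_0_compat; lra|].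
    exists (Nat.max N N'). intros K HK. specialize (HN K ltac:(lia)). specialize (HN' K ltac:(lia)).
    unfold R_dist in HN'. apply (Rmult_lt_compat_r (\| b n |)) in HN'; [|easy].
    replace (eps / 2 / \| b n | * \| b n |)%R with (eps / 2)%R in HN' by (field; lra).
    rewrite <- sn_norm_homog in HN'.
    set (s := vsum n (fun j => c K j *: b j)) in *. set (s' := vsum n (fun j => a j *: b j)) in *.
    replace (s + c K n *: b n - (s' + a n *: b n)) with ((s - s') + (c K n - a n) *: b n) by vec.
    pose proof (sn_norm_triangle X (s - s') ((c K n - a n) *: b n)). lra.
Qed.

(** Successive approximation as in the open mapping theorem: each correction halves the error and
    carries a [pbound] that also halves. The coordinates of the approximants converge, and
    uniqueness of expansions identifies their limits with the coordinates of [x]. *)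
Lemma psum_bounded_on_ball : exists C r, 0 < C /\ 0 < r /\ forall x, \| x | < r -> pbound C x.
Proof.
  destruct pbound_dense as [C [r [HC [Hr H]]]]. exists (2 * C)%R, r.
  split; [lra|]. split; [easy|]. intros x Hx.
  assert (Hstep : forall K S, exists S', \| x - S | < (/ 2) ^ K * r ->
     pbound ((/ 2) ^ K * C) (S' - S) /\ \| x - S' | < (/ 2) ^ (K + 1) * r).
  { intros K S. destruct (Rlt_dec (\| x - S |) ((/ 2) ^ K * r)) as [HS|HS]; [|now exists S].
    destruct (H ((/ 2) ^ K)%R (x - S) (half_pow_pos K) HS ((/ 2) ^ (K + 1) * r)%R) as [u [Hu1 Hu2]].
    { apply Rmult_lt_0_compat; [apply half_pow_pos|easy]. }
    exists (S + u). intros _. split.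
    - now replace (S + u - S) with u by vec.
    - rewrite norm_sub_sym. now replace (S + u - x) with (u - (x - S)) by vec. }
  set (step := fun K S => proj1_sig (constructive_indefinite_description _ (Hstep K S))).
  set (S := fix S K := match K with O => (sn_zero : X) | Datatypes.S K' => step K' (S K') end).
  assert (HS1 : forall K, \| x - S K | < (/ 2) ^ K * r ->
     pbound ((/ 2) ^ K * C) (S (Datatypes.S K) - S K) /\
     \| x - S (Datatypes.S K) | < (/ 2) ^ (K + 1) * r).
  { intros K. cbn. unfold step. now destruct constructive_indefinite_description. }
  assert (HS0 : S O = sn_zero) by easy. clearbody S. clear step Hstep.
  assert (HS2 : forall K, \| x - S K | < (/ 2) ^ K * r).
  { induction K as [|K IH].
    - rewrite HS0. replace (x - sn_zero) with x by vec. cbn. lra.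
    - replace (Datatypes.S K) with (K + 1)%nat at 2 by lia. now apply HS1. }
  assert (HS3 : forall K, pbound ((/ 2) ^ K * C) (S (Datatypes.S K) - S K)) by (intros; now apply HS1).
  (* The geometric sum of the bounds in [HS3], in closed form so that the induction closes. *)
  assert (HS4 : forall K d, pbound (2 * C * ((/ 2) ^ K - (/ 2) ^ (K + d))) (S (K + d)%nat - S K)).
  { intros K. induction d as [|d IH]; intros n.
    - rewrite Nat.add_0_r. replace (S K - S K) with (sn_zero : X) by vec.
      rewrite psum_zero, norm_zero. lra.
    - rewrite Nat.add_succ_r.
      replace (S (Datatypes.S (K + d)) - S K)
        with ((S (Datatypes.S (K + d)) - S (K + d)%nat) + (S (K + d)%nat - S K)) by vec.
      rewrite psum_add. pose proof (HS3 (K + d)%nat n) as K1. specialize (IH n).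
      change ((/ 2) ^ Datatypes.S (K + d))%R with (/ 2 * (/ 2) ^ (K + d))%R.
      match goal with |- \| ?p + ?q | <= _ => pose proof (sn_norm_triangle X p q) end. nra. }
  assert (HS : forall K m, (K <= m)%nat -> pbound (2 * C * (/ 2) ^ K) (S m - S K)).
  { intros K m Hm n. pose proof (HS4 K (m - K)%nat n) as K1.
    replace (K + (m - K))%nat with m in K1 by lia. pose proof (half_pow_pos m). nra. }
  assert (Ha : forall j, exists a, Un_cv (fun K => coord b (S K) j) a).
  { intros j. destruct (R_complete (fun K => coord b (S K) j)) as [a Ha]; [|now exists a].
    intros eps Heps. pose proof (basis_norm_pos j) as Hj.
    destruct (half_pow_small (8 * C / \| b j |) eps Heps) as [N HN].
    assert (K : forall m, (N <= m)%nat ->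
       Rabs (coord b (S m) j - coord b (S N) j) <= 4 * C / \| b j | * (/ 2) ^ N).
    { intros m Hm. pose proof (norm_coord_le _ j _ (HS N m Hm)) as K. rewrite coord_sub in K.
      apply (Rmult_le_reg_r (\| b j |)); [easy|].
      replace (4 * C / \| b j | * (/ 2) ^ N * \| b j |)%R with (4 * C * (/ 2) ^ N)%R by (field; lra).
      lra. }
    exists N. intros n m Hn Hm. unfold R_dist. pose proof (K n Hn) as Kn. pose proof (K m Hm) as Km.
    specialize (HN N (Nat.le_refl N)).
    replace (8 * C / \| b j | * (/ 2) ^ N)%R with (2 * (4 * C / \| b j | * (/ 2) ^ N))%R in HN
      by (field; lra).
    apply Rabs_le_inv in Kn, Km. apply Rabs_def1; lra. }
  apply choice in Ha. destruct Ha as [a Ha].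
  set (v := fun n => vsum n (fun j => a j *: b j)).
  (* For fixed [n] only finitely many coordinates converge, yet the resulting bound is uniform in
     [n]. *)
  assert (Hv : forall n K, \| v n - psum b n (S K) | <= 2 * C * (/ 2) ^ K).
  { intros n K. apply Rle_plus_epsilon. intros eps Heps.
    destruct (lincomb_cv n (fun K => coord b (S K)) a Ha eps Heps) as [N HN].
    specialize (HN (Nat.max N K) ltac:(lia)).
    pose proof (HS K (Nat.max N K) ltac:(lia) n) as K1. rewrite psum_sub in K1.
    pose proof (norm_sub_triangle X (psum b n (S (Nat.max N K))) (v n) (psum b n (S K))) as K2.
    rewrite (norm_sub_sym X (v n) (psum b n (S (Nat.max N K)))) in K2. unfold psum in *. fold (v n) in HN. lra. }
  (* The constant [2 * C + r] collects the errors of [Hv] and [HS2]. Uniformity of [Hv] allows [K]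
     to be fixed before [n]. *)
  assert (Hexp : expansion b a x).
  { intros eps Heps. destruct (half_pow_small (2 * C + r) (eps / 2) ltac:(lra)) as [K HK].
    specialize (HK K (Nat.le_refl K)).
    destruct (coord_spec (S K) (eps / 2)%R ltac:(lra)) as [N HN].
    exists N. intros n Hn. specialize (HN n Hn). fold (psum b n (S K)) in HN. fold (v n).
    specialize (Hv n K). specialize (HS2 K).
    pose proof (norm_sub_triangle X (psum b n (S K)) (v n) x).
    pose proof (norm_sub_triangle X (S K) (psum b n (S K)) x) as K3.
    rewrite (norm_sub_sym X (S K) x) in K3. lra. }
  intros n. assert (Hp : psum b n x = v n).
  { apply vsum_ext. intros i Hi. now rewrite (coord_unique a x Hexp). }
  rewrite Hp. specialize (Hv n O). rewrite HS0, psum_zero in Hv.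
  replace (v n - sn_zero) with (v n) in Hv by vec. cbn in Hv. lra.
Qed.

Theorem basis_constant : exists C, 0 < C /\ forall n x, \| psum b n x | <= C * \| x |.
Proof.
  destruct psum_bounded_on_ball as [C [r [HC [Hr H]]]].
  exists (2 * C / r)%R. split; [apply Rdiv_lt_0_compat; lra|]. intros n x.
  destruct (norm_nonneg X x) as [Hx|Hx].
  - specialize (H ((r / (2 * \| x |)) *: x)).
    assert (0 < r / (2 * \| x |)) by (apply Rdiv_lt_0_compat; lra).
    assert (K : pbound C ((r / (2 * \| x |)) *: x)).
    { apply H. rewrite sn_norm_homog, Rabs_right by lra.
      replace (r / (2 * \| x |) * \| x |)%R with (r / 2)%R by (field; lra). lra. }
    specialize (K n). rewrite psum_scal, sn_norm_homog, Rabs_right in K by lra.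
    apply (Rmult_le_compat_l (2 * \| x | / r)) in K; [|left; apply Rdiv_lt_0_compat; lra].
    replace (2 * \| x | / r * (r / (2 * \| x |) * \| psum b n x |))%R
      with (\| psum b n x |)%R in K by (field; lra).
    replace (2 * C / r * \| x |)%R with (2 * \| x | / r * C)%R by (field; lra). easy.
  - symmetry in Hx. pose proof (proj1 HX x Hx) as ->. rewrite psum_zero, norm_zero. lra.
Qed.

Lemma coord_functional j : bounded_linear_functional (fun x => coord b x j).
Proof.
  destruct basis_constant as [C [HC H]]. split; [|split].
  - intros. apply coord_add.
  - intros. apply coord_scal.
  - pose proof (basis_norm_pos j) as Hj. exists (2 * C / \| b j |)%R. intros x.
    apply (Rmult_le_reg_r (\| b j |)); [easy|].
    replace (2 * C / \| b j | * \| x | * \| b j |)%R with (2 * (C * \| x |))%R by (field; lra).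
    apply norm_coord_le. intros n. apply H.
Qed.

End Basis.

(** * Plegma limits *)

Lemma nth_map_seq (f : nat -> nat) n i : (i < n)%nat -> nth i (map f (seq 0 n)) O = f i.
Proof.
  intros H. rewrite (nth_indep _ O (f O)) by (now rewrite length_map, length_seq).
  rewrite map_nth, seq_nth; easy.
Qed.

Lemma le_of_eps x y c : (forall eps, 0 < eps -> x <= y + c * eps) -> x <= y.
Proof.
  intros H. apply Rle_plus_epsilon. intros eps Heps.
  assert (Hc : 0 < Rabs c + 1) by (pose proof (Rabs_pos c); lra).
  specialize (H (eps / (Rabs c + 1)) ltac:(now apply Rdiv_lt_0_compat)).
  assert (c * (eps / (Rabs c + 1)) <= eps); [|lra].
  apply Rle_trans with ((Rabs c + 1) * (eps / (Rabs c + 1))).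
  - apply Rmult_le_compat_r; [left; now apply Rdiv_lt_0_compat|]. pose proof (Rle_abs c). lra.
  - right. field. lra.
Qed.

Lemma interval_net eta : 0 < eta ->
  exists V : list R, forall r, -1 <= r <= 1 -> exists v, In v V /\ Rabs (r - v) <= eta.
Proof.
  intros He. destruct (INR_unbounded (2 / eta)) as [N HN].
  assert (HN2 : 2 <= INR N * eta).
  { apply (Rmult_lt_compat_r eta) in HN; [|easy].
    replace (2 / eta * eta) with 2 in HN by (field; lra). lra. }
  exists (map (fun i => -1 + INR i * eta) (seq 0 (S N))). intros r Hr.
  enough (K : forall p, r <= -1 + INR p * eta ->
      exists i, (i <= p)%nat /\ Rabs (r - (-1 + INR i * eta)) <= eta).
  { destruct (K N) as [i [Hi1 Hi2]]; [lra|]. eexists. split; [|exact Hi2].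
    apply (in_map (fun i => -1 + INR i * eta)). apply in_seq. lia. }
  induction p as [|p IH]; intros Hp.
  - cbn in Hp. exists O. split; [lia|]. cbn. apply Rabs_le. lra.
  - destruct (Rle_dec r (-1 + INR p * eta)) as [H|H].
    + destruct (IH H) as [i [Hi1 Hi2]]. exists i. split; [lia|easy].
    + exists (S p). split; [lia|]. rewrite S_INR in *. apply Rabs_le. lra.
Qed.

(** An ultrafilter is closed under finite intersections only; a finite net turns convergence at each
    coefficient vector into convergence uniform on the box. *)
Lemma box_net m eta : 0 < eta ->
  exists A : list (nat -> R), forall a : nat -> R, (forall j, (j < m)%nat -> -1 <= a j <= 1) ->
    exists a', In a' A /\ forall j, (j < m)%nat -> Rabs (a j - a' j) <= eta.
Proof.
  intros He. destruct (interval_net eta He) as [V HV]. induction m as [|m [A HA]].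
  - exists [fun _ => 0]. intros a _. exists (fun _ => 0). split; [now left|lia].
  - exists (flat_map (fun a' => map (fun v j => if Nat.eqb j m then v else a' j) V) A).
    intros a Ha. destruct (HA a) as [a' [H1 H2]]; [auto|].
    destruct (HV (a m)) as [v [Hv1 Hv2]]; [auto|].
    exists (fun j => if Nat.eqb j m then v else a' j). split.
    + apply in_flat_map. exists a'. split; [easy|].
      apply (in_map (fun v j => if Nat.eqb j m then v else a' j)). easy.
    + intros j Hj. destruct (Nat.eqb_spec j m) as [->|]; [easy|]. apply H2. lia.
Qed.

(* An increasing list of length [m * k] encodes a plegma family of [m] sets: it lists the first
   elements of the [m] sets, then their second elements, and so on. *)
Definition plegma_decode (k m : nat) (s : list nat) (j : nat) : list nat :=
  map (fun i => nth (i * m + j) s O) (seq 0 k).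

Definition plegma_encode (k m : nat) (ss : nat -> list nat) : list nat :=
  map (fun r => nth (r / m) (ss (r mod m)) O) (seq 0 (m * k)).

Lemma div_mod_block m i j : (j < m)%nat -> ((i * m + j) / m = i /\ (i * m + j) mod m = j)%nat.
Proof.
  intros H. split.
  - symmetry. apply Nat.div_unique with j; lia.
  - symmetry. apply Nat.mod_unique with i; lia.
Qed.

Lemma plegma_encode_kset k m ss :
  (1 <= m)%nat -> plegma_family all_N k m ss -> kset (m * k) (plegma_encode k m ss).
Proof.
  intros Hm [H1 [H2 H3]]. split; [unfold plegma_encode; now rewrite length_map, length_seq|].
  intros r Hr. unfold plegma_encode. rewrite !nth_map_seq by lia.
  pose proof (Nat.div_mod_eq r m) as Er. pose proof (Nat.mod_upper_bound r m ltac:(lia)) as Hj.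
  set (q := (r / m)%nat) in *. set (j := (r mod m)%nat) in *.
  assert (q < k)%nat by (apply Nat.mul_lt_mono_pos_l with m; lia).
  destruct (Nat.lt_ge_cases (j + 1) m) as [K|K].
  - replace (r + 1)%nat with (q * m + (j + 1))%nat by lia.
    destruct (div_mod_block m q (j + 1) K) as [-> ->]. now apply H2.
  - replace (r + 1)%nat with ((q + 1) * m + 0)%nat by lia.
    destruct (div_mod_block m (q + 1) 0 ltac:(lia)) as [-> ->].
    replace j with (m - 1)%nat by lia. apply H3; [easy|].
    apply Nat.mul_lt_mono_pos_l with m; lia.
Qed.

Lemma plegma_decode_encode k m ss M j :
  (forall j, (j < m)%nat -> length (ss j) = k) -> (j < m)%nat ->
  plegma_decode k m (map M (plegma_encode k m ss)) j = map M (ss j).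
Proof.
  intros H Hj. unfold plegma_decode.
  assert (E : map M (ss j) = map (fun i => M (nth i (ss j) O)) (seq 0 k)).
  { rewrite <- (map_map (fun i => nth i (ss j) O) M). f_equal.
    apply (nth_ext _ _ O O); [rewrite length_map, length_seq; auto|].
    intros i Hi. rewrite nth_map_seq; [easy|]. now rewrite <- (H j). }
  rewrite E. apply map_ext_in. intros i Hi. apply in_seq in Hi.
  assert (Hl : (i * m + j < m * k)%nat) by nia.
  rewrite (nth_indep _ O (M O)).
  - rewrite map_nth. f_equal. unfold plegma_encode. rewrite nth_map_seq by easy.
    now destruct (div_mod_block m i j Hj) as [-> ->].
  - unfold plegma_encode. now rewrite !length_map, length_seq.
Qed.

(** One block of [m] consecutive integers for each of the [k] entries. Any increasing selection of
    the [m] sets is therefore again plegma, which permits sums to be regrouped. *)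
Definition spread_family (k N m j : nat) : list nat := map (fun i => N + i * m + j)%nat (seq 0 k).

Lemma spread_family_plegma k N m n tau :
  (forall j, (j + 1 < n)%nat -> (tau j < tau (j + 1))%nat) ->
  (forall j, (j < n)%nat -> (tau j < m)%nat) ->
  plegma_family all_N k n (fun j => spread_family k N m (tau j)).
Proof.
  intros H1 H2. unfold spread_family. split; [|split].
  - intros j Hj. split; [split|].
    + now rewrite length_map, length_seq.
    + intros i Hi. rewrite !nth_map_seq by lia. specialize (H2 j Hj). lia.
    + intros v _. now exists v.
  - intros j i Hj Hi. rewrite !nth_map_seq by lia. specialize (H1 j Hj). lia.
  - intros Hn i Hi. rewrite !nth_map_seq by lia. specialize (H2 (n - 1)%nat ltac:(lia)). lia.
Qed.

Definition tensor (n : nat) (a a' : nat -> R) (r : nat) : R := a (r / n)%nat * a' (r mod n)%nat.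

Lemma tensor_block n (a a' : nat -> R) i l : (l < n)%nat -> tensor n a a' (i * n + l)%nat = (a i * a' l).
Proof. intros H. unfold tensor. now destruct (div_mod_block n i l H) as [-> ->]. Qed.

Lemma rsum_tensor m n (a a' : nat -> R) :
  rsum (m * n) (fun r => Rabs (tensor n a a' r))
  = (rsum m (fun i => Rabs (a i)) * rsum n (fun l => Rabs (a' l))).
Proof.
  rewrite rsum_mul, <- rsum_scal_r. apply rsum_ext. intros i Hi.
  rewrite (Rmult_comm (Rabs (a i))), <- rsum_scal_r. apply rsum_ext. intros l Hl.
  rewrite tensor_block by easy. rewrite Rabs_mult. ring.
Qed.

Lemma rsum_abs_one m (a : nat -> R) : rsum m (fun j => Rabs (a j)) = 1 ->
  (1 <= m)%nat /\ forall j, (j < m)%nat -> -1 <= a j <= 1.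
Proof.
  intros H. split.
  - destruct m; [cbn in H; lra|lia].
  - intros j Hj. apply Rabs_le_inv. rewrite <- H.
    apply (rsum_term_le m (fun j => Rabs (a j))); [intros; apply Rabs_pos|easy].
Qed.

Section PlegmaLimit.
Variable U : (nat -> Prop) -> Prop.
Hypothesis HU : ultra U.
Hypothesis U_free : forall n, U (fun i => (n < i)%nat).
Variable k : nat.
Hypothesis Hk : (1 <= k)%nat.
Variable X : SeminormedSpace.
Implicit Types (y : list nat -> X) (a : nat -> R).
Local Open Scope vec_scope.

Definition plegma_norm y m a (s : list nat) : R :=
  \| vsum m (fun j => a j *: y (plegma_decode k m s j)) |.

(** This is [rho_y m a]. It is a genuine limit when [y] is bounded on all lists, not only on
    increasing ones, because decoding is applied to arbitrary lists. *)
Definition plegma_lim y m a : R :=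
  epsilon (inhabits 0) (qlim (fun P => iter_q U (m * k) P []) (plegma_norm y m a)).

Definition bounded_by (B : R) y : Prop := forall s, \| y s | <= B.

Lemma plegma_norm_le y B m a s :
  bounded_by B y -> plegma_norm y m a s <= rsum m (fun j => Rabs (a j)) * B.
Proof. intros HB. apply norm_lincomb_le. intros. apply HB. Qed.

Lemma plegma_lim_spec y B m a :
  bounded_by B y -> qlim (fun P => iter_q U (m * k) P []) (plegma_norm y m a) (plegma_lim y m a).
Proof.
  intros HB. unfold plegma_lim. apply epsilon_spec.
  apply (qlim_exists (iter_q_ultra U HU (m * k) [])) with (rsum m (fun j => Rabs (a j)) * B)%R.
  intros s. rewrite Rabs_right; [now apply plegma_norm_le|].
  apply Rle_ge, norm_nonneg.
Qed.

Lemma plegma_lim_unique y B m a L :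
  bounded_by B y -> qlim (fun P => iter_q U (m * k) P []) (plegma_norm y m a) L ->
  plegma_lim y m a = L.
Proof.
  intros HB. apply (qlim_unique (iter_q_ultra U HU (m * k) [])). eapply plegma_lim_spec; eauto.
Qed.

Lemma plegma_lim_nonneg y B m a : bounded_by B y -> 0 <= plegma_lim y m a.
Proof.
  intros HB. pose proof (iter_q_ultra U HU (m * k) []) as HQ.
  apply (qlim_le HQ (fun _ => 0) _ _ _ (qlim_const HQ 0) (plegma_lim_spec y B m a HB)).
  apply (ultra_all HQ). intros s. apply norm_nonneg.
Qed.

Lemma plegma_lim_upper y B m a :
  bounded_by B y -> plegma_lim y m a <= rsum m (fun j => Rabs (a j)) * B.
Proof.
  intros HB. pose proof (iter_q_ultra U HU (m * k) []) as HQ.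
  apply (qlim_le HQ _ _ _ _ (plegma_lim_spec y B m a HB) (qlim_const HQ _)).
  apply (ultra_all HQ). intros s. now apply plegma_norm_le.
Qed.

Lemma plegma_lim_homog y B m a c :
  bounded_by B y -> plegma_lim y m (fun j => c * a j)%R = (Rabs c * plegma_lim y m a)%R.
Proof.
  intros HB. pose proof (iter_q_ultra U HU (m * k) []) as HQ.
  apply plegma_lim_unique with B; [easy|].
  apply (qlim_ext HQ (fun s => Rabs c * plegma_norm y m a s)%R).
  - intros s. unfold plegma_norm. rewrite <- sn_norm_homog, <- vsum_scal. f_equal.
    apply vsum_ext. intros. apply sn_scal_assoc.
  - apply (qlim_scal HQ). eapply plegma_lim_spec; eauto.
Qed.

Lemma plegma_lim_triangle y B m a a' :
  bounded_by B y -> plegma_lim y m (fun j => a j + a' j)%R <= plegma_lim y m a + plegma_lim y m a'.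
Proof.
  intros HB. pose proof (iter_q_ultra U HU (m * k) []) as HQ.
  apply (qlim_le HQ _ _ _ _ (plegma_lim_spec y B m _ HB)
    (qlim_plus HQ _ _ _ _ (plegma_lim_spec y B m a HB) (plegma_lim_spec y B m a' HB))).
  apply (ultra_all HQ). intros s. unfold plegma_norm.
  eapply Rle_trans; [|apply sn_norm_triangle]. right. f_equal. rewrite <- vsum_add.
  apply vsum_ext. intros. apply sn_scal_distr_r.
Qed.

Lemma plegma_lim_ext y B m a a' :
  bounded_by B y -> (forall j, (j < m)%nat -> a j = a' j) -> plegma_lim y m a = plegma_lim y m a'.
Proof.
  intros HB H. pose proof (iter_q_ultra U HU (m * k) []) as HQ.
  apply plegma_lim_unique with B; [easy|].
  apply (qlim_ext HQ (plegma_norm y m a')); [|eapply plegma_lim_spec; eauto].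
  intros s. unfold plegma_norm. f_equal. apply vsum_ext. intros j Hj. now rewrite H.
Qed.

Lemma plegma_norm_lipschitz y B m a a' s eta :
  bounded_by B y -> (forall j, (j < m)%nat -> Rabs (a j - a' j) <= eta) ->
  plegma_norm y m a s <= plegma_norm y m a' s + INR m * eta * B.
Proof.
  intros HB H. unfold plegma_norm.
  eapply Rle_trans; [apply (norm_le_sub X _ (vsum m (fun j => a' j *: y (plegma_decode k m s j))))|].
  apply Rplus_le_compat_l. rewrite vsum_sub.
  rewrite (vsum_ext _ m _ (fun j => (a j - a' j)%R *: y (plegma_decode k m s j))) by (intros; vec).
  eapply Rle_trans; [apply norm_lincomb_le; intros; apply HB|].
  apply Rmult_le_compat_r; [eapply Rle_trans; [apply norm_nonneg|apply (HB [])]|].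
  rewrite <- rsum_const. now apply rsum_le.
Qed.

Lemma plegma_lim_lipschitz y B m a a' eta :
  bounded_by B y -> (forall j, (j < m)%nat -> Rabs (a j - a' j) <= eta) ->
  plegma_lim y m a <= plegma_lim y m a' + INR m * eta * B.
Proof.
  intros HB H. pose proof (iter_q_ultra U HU (m * k) []) as HQ.
  apply (qlim_le HQ _ _ _ _ (plegma_lim_spec y B m a HB)
    (qlim_plus HQ _ _ _ _ (plegma_lim_spec y B m a' HB) (qlim_const HQ (INR m * eta * B)%R))).
  apply (ultra_all HQ). intros s. now apply plegma_norm_lipschitz.
Qed.

Lemma plegma_norm_uniform y B m eps :
  bounded_by B y -> 0 < eps ->
  iter_q U (m * k) (fun s => forall a, (forall j, (j < m)%nat -> -1 <= a j <= 1) ->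
    Rabs (plegma_norm y m a s - plegma_lim y m a) <= eps) [].
Proof.
  intros HB Heps. pose proof (iter_q_ultra U HU (m * k) []) as HQ.
  assert (HB0 : 0 <= B) by (eapply Rle_trans; [apply norm_nonneg|apply (HB [])]).
  assert (HmB : 0 <= INR m * B) by (apply Rmult_le_pos; [apply pos_INR|easy]).
  (* A third of [eps] for each passage between [a] and the net, once for the norm and once for the
     limit, and a third at the net point. The [+ 1] keeps the divisor positive. *)
  set (eta := (eps / (3 * (INR m * B + 1)))%R).
  assert (He : 0 < eta) by (apply Rdiv_lt_0_compat; lra).
  assert (He2 : INR m * eta * B <= eps / 3).
  { replace (eps / 3)%R with ((INR m * B + 1) * eta)%R by (unfold eta; field; lra). nra. }
  destruct (box_net m eta He) as [A HA].
  assert (K : iter_q U (m * k) (fun s => forall a, In a A ->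
    Rabs (plegma_norm y m a s - plegma_lim y m a) < eps / 3) []).
  { apply (ultra_forall_list HQ A). intros a _. apply (plegma_lim_spec y B m a HB). lra. }
  revert K. apply (ultra_mono _ HQ). intros s Hs a Ha.
  destruct (HA a Ha) as [a' [Ha1 Ha2]]. specialize (Hs a' Ha1).
  assert (Ha3 : forall j, (j < m)%nat -> Rabs (a' j - a j) <= eta)
    by (intros; rewrite Rabs_minus_sym; auto).
  pose proof (plegma_norm_lipschitz y B m a a' s eta HB Ha2).
  pose proof (plegma_norm_lipschitz y B m a' a s eta HB Ha3).
  pose proof (plegma_lim_lipschitz y B m a a' eta HB Ha2).
  pose proof (plegma_lim_lipschitz y B m a' a eta HB Ha3).
  apply Rabs_def2 in Hs. apply Rabs_le. lra.
Qed.

(* In this statement [ss] is a family of sets of positions in [M]. *)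
Lemma plegma_ramsey y B (G : list nat -> nat -> Prop) :
  bounded_by B y -> (forall F, U (G F)) ->
  exists M, infinite_enum M /\ (forall p, G (map M (seq 0 p)) (M p)) /\
    forall l m a ss, (m <= l)%nat -> (forall j, (j < m)%nat -> -1 <= a j <= 1) ->
      plegma_family all_N k m ss -> (l <= nth 0 (ss 0%nat) 0)%nat ->
      Rabs (\| vsum m (fun j => a j *: y (map M (ss j))) | - plegma_lim y m a) <= / INR (S l).
Proof.
  intros HB HG.
  destruct (ultra_ramsey U HU U_free (fun m => m * k)%nat
    (fun l m s => forall a, (forall j, (j < m)%nat -> -1 <= a j <= 1) ->
      Rabs (plegma_norm y m a s - plegma_lim y m a) <= / INR (S l)) G) as [M [HM1 [HM2 HM3]]]; [|easy|].
  { intros l m _. apply plegma_norm_uniform with B; [easy|]. apply inv_INR_pos. }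
  exists M. split; [easy|]. split; [easy|]. intros l m a ss Hm Ha Hss Hl.
  (* An empty family has no first set, so the head bound is void and the empty list of positions is
     used instead. *)
  destruct m as [|m].
  - apply (HM3 l O []); [easy| |easy|easy]. split; [easy|lia].
  - pose proof (plegma_encode_kset k (S m) ss ltac:(lia) Hss) as Hks.
    assert (Hlen : forall j, (j < S m)%nat -> length (ss j) = k).
    { intros j Hj. apply Hss. easy. }
    replace (vsum (S m) (fun j => a j *: y (map M (ss j))))
      with (vsum (S m) (fun j => a j *:
        y (plegma_decode k (S m) (map M (plegma_encode k (S m) ss)) j))).
    + apply (HM3 l (S m) (plegma_encode k (S m) ss)); [easy|easy| |easy].
      intros v Hv. apply (In_nth _ _ O) in Hv. destruct Hv as [r [Hr <-]].
      destruct Hks as [Hk1 Hk2]. rewrite Hk1 in Hr.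
      assert (E : nth 0 (plegma_encode k (S m) ss) O = nth 0 (ss O) O).
      { unfold plegma_encode. rewrite nth_map_seq by lia. now rewrite Nat.Div0.div_0_l, Nat.Div0.mod_0_l. }
      destruct r as [|r]; [lia|].
      pose proof (kset_nth_lt _ _ 0 (S r) (conj Hk1 Hk2) ltac:(lia)). lia.
    + apply vsum_ext. intros j Hj. now rewrite plegma_decode_encode.
Qed.

Lemma spread_family_head N m j : nth 0 (spread_family k N m j) O = (N + j)%nat.
Proof. unfold spread_family. rewrite nth_map_seq by easy. lia. Qed.

(** A local model of the limit: one finite sequence of vectors of [X] all of whose increasing
    subsequences realize the limit up to [eps]. Regrouping arguments then become identities between
    sums in [X]. *)
Lemma plegma_lim_approx y B eps :
  bounded_by B y -> 0 < eps -> forall m, exists w : nat -> X,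
    forall n a tau, (n <= m)%nat -> (forall j, (j < n)%nat -> -1 <= a j <= 1) ->
      (forall j, (j + 1 < n)%nat -> (tau j < tau (j + 1))%nat) ->
      (forall j, (j < n)%nat -> (tau j < m)%nat) ->
      Rabs (\| vsum n (fun j => a j *: w (tau j)) | - plegma_lim y n a) <= eps.
Proof.
  intros HB Heps m.
  destruct (plegma_ramsey y B (fun _ _ => True) HB) as [M [_ [_ HM]]].
  { intros F. now apply (ultra_all HU). }
  destruct (rinv_small eps Heps) as [N HN].
  set (L := Nat.max N m).
  exists (fun j => y (map M (spread_family k L m j))). intros n a tau Hn Ha H1 H2.
  specialize (HN L ltac:(lia)).
  specialize (HM L n a (fun j => spread_family k L m (tau j)) ltac:(lia) Ha
    (spread_family_plegma k L m n tau H1 H2)).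
  cbn beta in HM. rewrite spread_family_head in HM. specialize (HM ltac:(lia)). lra.
Qed.

Lemma plegma_lim_pad y B m n a :
  bounded_by B y -> (n <= m)%nat -> (forall j, (n <= j < m)%nat -> a j = 0) ->
  plegma_lim y m a = plegma_lim y n a.
Proof.
  intros HB Hn Ha.
  (* The local model only covers coefficients in the unit box; the general case follows by
     homogeneity after division by [c]. *)
  assert (Hunit : forall a, (forall j, (n <= j < m)%nat -> a j = 0) ->
     (forall j, (j < m)%nat -> -1 <= a j <= 1) -> plegma_lim y m a = plegma_lim y n a).
  { clear a Ha. intros a Ha Ha1. apply cond_eq. intros eps Heps.
    destruct (plegma_lim_approx y B (eps / 3) HB ltac:(lra) m) as [w Hw].
    pose proof (Hw m a (fun j => j) (Nat.le_refl m) Ha1 ltac:(cbn beta; intros; lia) ltac:(cbn beta; intros; lia)) as K1.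
    pose proof (Hw n a (fun j => j) Hn ltac:(intros; apply Ha1; lia) ltac:(cbn beta; intros; lia)
      ltac:(cbn beta; intros; lia)) as K2.
    replace m with (n + (m - n))%nat in K1 at 1 by lia. rewrite vsum_split in K1.
    rewrite (vsum_zero _ (m - n)) in K1.
    - rewrite sn_add_zero in K1. apply Rabs_le_inv in K1, K2. apply Rabs_def1; lra.
    - intros i Hi. rewrite Ha by lia. apply scal_zero_l. }
  set (c := (rsum m (fun j => Rabs (a j)) + 1)%R).
  assert (Hc : 0 < c).
  { assert (0 <= rsum m (fun j => Rabs (a j))) by (apply rsum_nonneg; intros; apply Rabs_pos).
    unfold c. lra. }
  set (a1 := fun j => (/ c * a j)%R).
  assert (E : forall r, plegma_lim y r a = (c * plegma_lim y r a1)%R).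
  { intros r. unfold a1. rewrite plegma_lim_homog with (B := B) by easy.
    rewrite Rabs_right by (left; now apply Rinv_0_lt_compat). field. lra. }
  rewrite !E. f_equal. apply Hunit.
  - intros j Hj. unfold a1. rewrite Ha by easy. ring.
  - intros j Hj. assert (Hle : Rabs (a j) <= c).
    { pose proof (rsum_term_le m (fun j => Rabs (a j)) j ltac:(intros; apply Rabs_pos) Hj).
      cbn beta in *. unfold c. lra. }
    apply Rabs_le_inv. unfold a1. rewrite Rabs_mult, Rabs_right by (left; now apply Rinv_0_lt_compat).
    apply (Rmult_le_reg_l c); [easy|]. rewrite <- Rmult_assoc, Rinv_r by lra. lra.
Qed.

(* The tensor product groups either into [m] spread copies of [a'] or into [n] spread copies
   of [a], so it is small whenever one of its factors is. *)
Lemma plegma_lim_tensor y B m n a a' :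
  bounded_by B y -> (1 <= m)%nat -> (1 <= n)%nat ->
  (forall j, (j < m)%nat -> -1 <= a j <= 1) -> (forall j, (j < n)%nat -> -1 <= a' j <= 1) ->
  plegma_lim y (m * n) (tensor n a a') <= rsum m (fun i => Rabs (a i)) * plegma_lim y n a' /\
  plegma_lim y (m * n) (tensor n a a') <= rsum n (fun l => Rabs (a' l)) * plegma_lim y m a.
Proof.
  intros HB Hm Hn Ha Ha'.
  assert (Ht : forall j, (j < m * n)%nat -> -1 <= tensor n a a' j <= 1).
  { intros j Hj. unfold tensor. apply Rabs_le_inv. rewrite Rabs_mult.
    assert (K1 : Rabs (a (j / n)%nat) <= 1).
    { apply Rabs_le, Ha. apply Nat.Div0.div_lt_upper_bound. lia. }
    assert (K2 : Rabs (a' (j mod n)%nat) <= 1).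
    { apply Rabs_le, Ha'. apply Nat.mod_upper_bound. lia. }
    pose proof (Rabs_pos (a (j / n)%nat)). pose proof (Rabs_pos (a' (j mod n)%nat)). nra. }
  assert (K : forall eps, 0 < eps ->
    plegma_lim y (m * n) (tensor n a a')
      <= rsum m (fun i => Rabs (a i)) * (plegma_lim y n a' + eps) + eps /\
    plegma_lim y (m * n) (tensor n a a')
      <= rsum n (fun l => Rabs (a' l)) * (plegma_lim y m a + eps) + eps).
  { intros eps Heps. destruct (plegma_lim_approx y B eps HB Heps (m * n)) as [w Hw].
    pose proof (Hw (m * n)%nat (tensor n a a') (fun j => j) (Nat.le_refl _) Ht
      ltac:(cbn beta; intros; lia) ltac:(cbn beta; intros; lia)) as K.
    apply Rabs_le_inv in K. split.
    - rewrite vsum_mul in K.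
      rewrite (vsum_ext _ m _ (fun i => a i *: vsum n (fun l => a' l *: w (i * n + l)%nat))) in K.
      + pose proof (norm_lincomb_le X m a (fun i => vsum n (fun l => a' l *: w (i * n + l)%nat))
          (plegma_lim y n a' + eps)%R) as K2. cbn beta in K2.
        eapply Rle_trans; [|apply Rplus_le_compat_r, K2]; [lra|]. intros i Hi.
        pose proof (Hw n a' (fun l => i * n + l)%nat ltac:(nia) Ha' ltac:(cbn beta; intros; lia)
          ltac:(cbn beta; intros; nia)) as K1.
        apply Rabs_le_inv in K1. lra.
      + intros i Hi. rewrite <- vsum_scal. apply vsum_ext. intros l Hl.
        rewrite tensor_block by easy. vec.
    - rewrite vsum_mul, vsum_exchange in K.
      rewrite (vsum_ext _ n _ (fun l => a' l *: vsum m (fun i => a i *: w (i * n + l)%nat))) in K.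
      + pose proof (norm_lincomb_le X n a' (fun l => vsum m (fun i => a i *: w (i * n + l)%nat))
          (plegma_lim y m a + eps)%R) as K2. cbn beta in K2.
        eapply Rle_trans; [|apply Rplus_le_compat_r, K2]; [lra|]. intros l Hl.
        pose proof (Hw m a (fun i => i * n + l)%nat ltac:(nia) Ha ltac:(cbn beta; intros; nia)
          ltac:(cbn beta; intros; nia)) as K1.
        apply Rabs_le_inv in K1. lra.
      + intros l Hl. rewrite <- vsum_scal. apply vsum_ext. intros i Hi.
        rewrite tensor_block by easy. vec. }
  split.
  - apply le_of_eps with (rsum m (fun i => Rabs (a i)) + 1)%R. intros eps Heps.
    destruct (K eps Heps). lra.
  - apply le_of_eps with (rsum n (fun i => Rabs (a' i)) + 1)%R. intros eps Heps.
    destruct (K eps Heps). lra.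
Qed.

(** * Failure of the lower l1 estimate *)

Definition lacks_l1 y : Prop :=
  forall eps, 0 < eps -> exists m a, rsum m (fun j => Rabs (a j)) = 1 /\ plegma_lim y m a <= eps.

Lemma lacks_l1_common (ys : list (list nat -> X)) :
  (forall y, In y ys -> (exists B, bounded_by B y) /\ lacks_l1 y) ->
  forall eps, 0 < eps -> exists m a, rsum m (fun j => Rabs (a j)) = 1 /\
    forall y, In y ys -> plegma_lim y m a <= eps.
Proof.
  induction ys as [|y ys IH]; intros H eps Heps.
  - exists 1%nat, (fun _ => 1). split; [cbn; rewrite Rabs_R1; ring|easy].
  - destruct (IH ltac:(intros; apply H; now right) eps Heps) as [m [a [Ha1 Ha2]]].
    destruct (H y) as [[B HB] Hy]; [now left|]. destruct (Hy eps Heps) as [n [a' [Ha1' Ha2']]].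
    destruct (rsum_abs_one m a Ha1) as [Hm Ha]. destruct (rsum_abs_one n a' Ha1') as [Hn Ha'].
    exists (m * n)%nat, (tensor n a a'). split; [rewrite rsum_tensor, Ha1, Ha1'; ring|].
    (* The new part is small through the right factor [a'], the earlier ones through the left factor
       [a]. *)
    intros z [<-|Hz].
    + destruct (plegma_lim_tensor y B m n a a' HB Hm Hn Ha Ha') as [K _]. rewrite Ha1 in K. lra.
    + destruct (H z) as [[B' HB'] _]; [now right|].
      destruct (plegma_lim_tensor z B' m n a a' HB' Hm Hn Ha Ha') as [_ K]. rewrite Ha1' in K.
      specialize (Ha2 z Hz). lra.
Qed.

Lemma not_lacks_l1 y B : bounded_by B y -> ~ lacks_l1 y ->
  exists c, 0 < c /\ forall m a, c * rsum m (fun j => Rabs (a j)) <= plegma_lim y m a.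
Proof.
  intros HB H. apply not_all_ex_not in H. destruct H as [c H]. apply imply_to_and in H.
  destruct H as [Hc H]. exists c. split; [easy|]. intros m a.
  set (S := rsum m (fun j => Rabs (a j))).
  assert (HS : 0 <= S) by (apply rsum_nonneg; intros; apply Rabs_pos).
  destruct HS as [HS|HS].
  - assert (HiS : 0 < / S) by now apply Rinv_0_lt_compat.
    apply Rnot_lt_le. intros K. apply H. exists m, (fun j => / S * a j)%R. split.
    + rewrite (rsum_ext m _ (fun j => Rabs (a j) * / S)%R).
      * rewrite rsum_scal_r. fold S. field. lra.
      * intros j Hj. rewrite Rabs_mult, (Rabs_right (/ S)) by lra. ring.
    + rewrite plegma_lim_homog with (B := B) by easy. rewrite Rabs_right by lra.
      apply (Rmult_le_reg_l S); [easy|]. rewrite <- Rmult_assoc, Rinv_r by lra. lra.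
  - rewrite <- HS, Rmult_0_r. eapply plegma_lim_nonneg; eauto.
Qed.

End PlegmaLimit.

(** * Realizing a seminorm on finitely supported sequences *)

(** The axioms of [SeminormedSpace] are Leibniz equalities, so the bound on the support is hidden in
    a proof: sequences that agree pointwise are then equal elements. *)
Definition c00 : Type := {f : nat -> R | exists n, forall j, (n <= j)%nat -> f j = 0}.

Lemma c00_eq (f g : c00) : (forall j, proj1_sig f j = proj1_sig g j) -> f = g.
Proof.
  destruct f as [f Hf], g as [g Hg]. cbn. intros H.
  apply subset_eq_compat. now apply functional_extensionality.
Qed.

Definition c00_zero : c00.
Proof. exists (fun _ => 0). now exists O. Defined.

Definition c00_add (f g : c00) : c00.
Proof.
  exists (fun j => proj1_sig f j + proj1_sig g j).
  destruct f as [f [n Hn]], g as [g [m Hm]]. exists (Nat.max n m). intros j Hj. cbn.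
  rewrite Hn, Hm by lia. ring.
Defined.

Definition c00_scal (c : R) (f : c00) : c00.
Proof.
  exists (fun j => c * proj1_sig f j).
  destruct f as [f [n Hn]]. exists n. intros j Hj. cbn. rewrite Hn by easy. ring.
Defined.

Definition c00_unit (i : nat) : c00.
Proof.
  exists (fun j => if Nat.eqb j i then 1 else 0).
  exists (S i). intros j Hj. destruct (Nat.eqb_spec j i); [lia|easy].
Defined.

(** Turns limits that are defined only on coefficient vectors into a space. Invariance under padding
    by zeros makes the seminorm independent of the bound chosen on the support. *)
Lemma c00_seminorm_space (rho : nat -> (nat -> R) -> R) :
  (forall n a a', (forall j, (j < n)%nat -> a j = a' j) -> rho n a = rho n a') ->
  (forall n m a, (n <= m)%nat -> (forall j, (n <= j < m)%nat -> a j = 0) -> rho m a = rho n a) ->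
  (forall n a c, rho n (fun j => c * a j) = Rabs c * rho n a) ->
  (forall n a a', rho n (fun j => a j + a' j) <= rho n a + rho n a') ->
  exists (E : SeminormedSpace) (e : nat -> E), hamel_basis e /\
    forall n a, sn_norm (vsum n (fun j => sn_scal (a j) (e j))) = rho n a.
Proof.
  intros Hext Hpad Hhom Htri.
  set (bd := fun f : c00 => proj1_sig (constructive_indefinite_description _ (proj2_sig f))).
  assert (Hbd : forall f j, (bd f <= j)%nat -> proj1_sig f j = 0).
  { intros f. unfold bd. now destruct constructive_indefinite_description. }
  set (N := fun f : c00 => rho (bd f) (proj1_sig f)).
  assert (HN : forall (f : c00) n, (forall j, (n <= j)%nat -> proj1_sig f j = 0) ->
     N f = rho n (proj1_sig f)).
  { intros f n Hn. unfold N. destruct (Nat.le_ge_cases n (bd f)) as [H|H].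
    - apply Hpad; [easy|]. intros j Hj. apply Hn. lia.
    - symmetry. apply Hpad; [easy|]. intros j Hj. apply Hbd. lia. }
  clearbody N.
  unshelve eset (E := {| sn_car := c00; sn_zero := c00_zero; sn_add := c00_add;
    sn_opp := c00_scal (-1); sn_scal := c00_scal; sn_norm := N |}).
  1-8: intros; apply c00_eq; intros; cbn; ring.
  - intros c f. rewrite (HN f (bd f)) by apply Hbd. rewrite (HN (c00_scal c f) (bd f)); [apply Hhom|].
    intros j Hj. cbn. rewrite Hbd by easy. ring.
  - intros f g. set (m := Nat.max (bd f) (bd g)).
    rewrite (HN f m), (HN g m), (HN (c00_add f g) m); [apply Htri| | |];
      intros j Hj; unfold m in Hj; cbn; rewrite ?Hbd by lia; lra.
  - assert (HS : forall n (a : nat -> R) j,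
      proj1_sig (vsum n (fun j => sn_scal (a j) (c00_unit j : E)) : c00) j
      = if Nat.ltb j n then a j else 0).
    { intros n a j. induction n as [|n IH]; [easy|].
      transitivity (proj1_sig (vsum n (fun j => sn_scal (a j) (c00_unit j : E)) : c00) j
        + a n * (if Nat.eqb j n then 1 else 0)); [reflexivity|]. rewrite IH.
      destruct (Nat.eqb_spec j n) as [->|Hj].
      - destruct (Nat.ltb_spec n n); [lia|]. destruct (Nat.ltb_spec n (S n)); [ring|lia].
      - destruct (Nat.ltb_spec j n), (Nat.ltb_spec j (S n)); try lia; ring. }
    exists E, (c00_unit : nat -> E). split; [split|].
    + intros n a H j Hj. specialize (HS n a j). rewrite H in HS.
      destruct (Nat.ltb_spec j n); [now symmetry|lia].
    + intros v. exists (bd v), (proj1_sig v). apply c00_eq. intros j. rewrite HS.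
      destruct (Nat.ltb_spec j (bd v)); [easy|]. now apply Hbd.
    + intros n a. cbn [sn_norm E]. rewrite (HN _ n).
      * apply Hext. intros j Hj. rewrite HS. now destruct (Nat.ltb_spec j n); [|lia].
      * intros j Hj. rewrite HS. now destruct (Nat.ltb_spec j n); [lia|].
Qed.

(** * Coordinatewise ultralimits *)

Section WeakLimits.
Variable U : (nat -> Prop) -> Prop.
Hypothesis HU : ultra U.
Variable X : SeminormedSpace.
Variable b : nat -> X.
Hypothesis HX : is_banach X.
Hypothesis Hb : schauder_basis b.
Local Open Scope vec_scope.

(** If no such limit existed, the weakly open sets avoided by [U]-many [u i] would cover [K]. Some
    [u i] would avoid a whole finite subcover while lying in [K]. *)
Lemma weak_ultralimit (K : X -> Prop) (u : nat -> X) :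
  weakly_compact K -> (forall i, K (u i)) ->
  exists x, K x /\ forall j, qlim U (fun i => coord b (u i) j) (coord b x j).
Proof.
  intros HK Hu. apply NNPP. intros H.
  destruct (HK {V : X -> Prop | weak_open V /\ U (fun i => ~ V (u i))} (@proj1_sig _ _))
    as [L HL].
  - intros [V HV]. apply HV.
  - intros x Hx.
    assert (Hex : exists j eps, 0 < eps /\ ~ U (fun i => Rabs (coord b (u i) j - coord b x j) < eps)).
    { apply NNPP. intros K1. apply H. exists x. split; [easy|]. intros j eps Heps.
      apply NNPP. intros K2. apply K1. now exists j, eps. }
    destruct Hex as [j [eps [Heps Hj]]].
    unshelve eexists (exist _ (fun z => Rabs (coord b z j - coord b x j) < eps) _).
    + split.
      * intros z Hz. exists [fun z => coord b z j], (eps - Rabs (coord b z j - coord b x j))%R.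
        split; [|split].
        -- intros f [<-|[]]. now apply coord_functional.
        -- lra.
        -- intros v Hv. specialize (Hv _ (or_introl eq_refl)). cbn in Hv.
           replace (coord b v j - coord b x j)%R
             with ((coord b v j - coord b z j) + (coord b z j - coord b x j))%R by ring.
           eapply Rle_lt_trans; [apply Rabs_triang|]. lra.
      * destruct (ultra_em _ HU (fun i => Rabs (coord b (u i) j - coord b x j) < eps)); easy.
    + cbn. now rewrite Rminus_diag, Rabs_R0.
  - assert (K1 : U (fun i => forall V, In V L -> ~ proj1_sig V (u i))).
    { apply (ultra_forall_list HU L). intros [V HV] _. apply HV. }
    apply (ultra_ex HU) in K1. destruct K1 as [i Hi].
    destruct (HL (u i) (Hu i)) as [V [HV1 HV2]]. now apply (Hi V).
Qed.

Lemma psum_null n (v : nat -> X) :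
  (forall j, qlim U (fun i => coord b (v i) j) 0) ->
  forall eps, 0 < eps -> U (fun i => \| psum b n (v i) | < eps).
Proof.
  intros H. unfold psum. induction n as [|n IH]; intros eps Heps; cbn [vsum].
  - apply (ultra_all HU). intros. now rewrite norm_zero.
  - pose proof (basis_norm_pos X b HX Hb n) as Hn.
    assert (He : 0 < eps / 2 / \| b n |) by (apply Rdiv_lt_0_compat; lra).
    generalize (ultra_and _ HU _ _ (IH (eps / 2)%R ltac:(lra)) (H n _ He)).
    apply (ultra_mono _ HU). intros i [H1 H2]. rewrite Rminus_0_r in H2.
    apply (Rmult_lt_compat_r (\| b n |)) in H2; [|easy].
    replace (eps / 2 / \| b n | * \| b n |)%R with (eps / 2)%R in H2 by (field; lra).
    rewrite <- sn_norm_homog in H2.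
    eapply Rle_lt_trans; [apply sn_norm_triangle|]. lra.
Qed.

Lemma coord_qlim_sub (u : nat -> X) x j :
  qlim U (fun i => coord b (u i) j) (coord b x j) ->
  qlim U (fun i => coord b (u i - x) j) 0.
Proof.
  intros H eps Heps. generalize (H eps Heps). apply (ultra_mono _ HU). intros i Hi.
  now rewrite coord_sub, Rminus_0_r.
Qed.

(** With coordinates alone under control, the basis constant stands in for weak lower semicontinuity
    of the norm: a partial sum close to [x] is close to the same partial sum of some [u i]. *)
Lemma ultralimit_norm C B (u : nat -> X) x :
  (forall n x, \| psum b n x | <= C * \| x |) -> 0 < C ->
  (forall i, \| u i | <= B) ->
  (forall j, qlim U (fun i => coord b (u i) j) (coord b x j)) -> \| x | <= C * B.
Proof.
  intros HC HC0 HB H. apply Rle_plus_epsilon. intros eps Heps.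
  destruct (coord_spec X b Hb x (eps / 2)%R ltac:(lra)) as [n Hn].
  specialize (Hn n (Nat.le_refl n)). fold (psum b n x) in Hn.
  assert (K : U (fun i => \| psum b n (u i - x) | < eps / 2)).
  { apply psum_null; [|lra]. intros j. now apply coord_qlim_sub. }
  apply (ultra_ex HU) in K. destruct K as [i Hi]. rewrite psum_sub in Hi by easy.
  specialize (HC n (u i)). specialize (HB i).
  pose proof (norm_le_sub X x (psum b n x)) as K1.
  pose proof (norm_le_sub X (psum b n x) (psum b n (u i))) as K2.
  rewrite norm_sub_sym in K1. rewrite (norm_sub_sym X (psum b n x) (psum b n (u i))) in K2.
  assert (C * \| u i | <= C * B)%R by (apply Rmult_le_compat_l; lra). lra.
Qed.

(** Each limit stays in [K], so limits can be taken again, the last entry of the list being removed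
    each time. The norm bound may grow by the basis constant at every level. *)
Lemma iterated_ultralimits (K : X -> Prop) (x0 : list nat -> X) B :
  weakly_compact K -> (forall s, K (x0 s)) -> bounded_by X B x0 ->
  exists T : nat -> list nat -> X, T O = x0 /\
    (forall r t j, qlim U (fun i => coord b (T r (t ++ [i])) j) (coord b (T (S r) t) j)) /\
    forall r, exists B, bounded_by X B (T r).
Proof.
  intros HK Hx0 HB.
  assert (Hstep : forall g : list nat -> X, exists g', (forall t, K (g t)) ->
    (forall t, K (g' t)) /\
    forall t j, qlim U (fun i => coord b (g (t ++ [i])) j) (coord b (g' t) j)).
  { intros g. destruct (classic (forall t, K (g t))) as [Hg|Hg]; [|now exists g].
    destruct (choice (fun t x => K x /\
      forall j, qlim U (fun i => coord b (g (t ++ [i])) j) (coord b x j))) as [g' Hg'].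
    - intros t. apply (weak_ultralimit K (fun i => g (t ++ [i]))); auto.
    - exists g'. intros _. split; intros; apply Hg'. }
  apply choice in Hstep. destruct Hstep as [step Hstep].
  set (T := fix T r := match r with O => x0 | S r' => step (T r') end).
  assert (HT : forall r t, K (T r t)).
  { induction r as [|r IH]; [easy|]. now apply Hstep. }
  exists T. split; [easy|]. split.
  - intros r. now apply Hstep.
  - destruct (basis_constant X b HX Hb) as [C [HC0 HC]].
    induction r as [|r [B' IH]]; [now exists B|]. exists (C * B')%R. intros t.
    apply ultralimit_norm with (fun i => T r (t ++ [i])); auto.
    intros j. now apply Hstep.
Qed.

Lemma coord_psum n x i : coord b (psum b n x) i = if Nat.ltb i n then coord b x i else 0.
Proof.
  apply (coord_unique X b Hb (fun j => if Nat.ltb j n then coord b x j else 0)).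
  apply expansion_finite.
Qed.

Lemma uniform_tail (L : list X) eps :
  0 < eps -> exists Q, forall x, In x L -> forall q, (Q <= q)%nat -> \| psum b q x - x | < eps.
Proof.
  intros Heps. induction L as [|x L [Q HQ]]; [now exists O|].
  destruct (coord_spec X b Hb x eps Heps) as [Q' HQ'].
  exists (Nat.max Q Q'). intros z [<-|Hz] q Hq.
  - apply HQ'. lia.
  - apply HQ; [easy|lia].
Qed.

End WeakLimits.

(** * Plegma families along an infinite set *)

Lemma nth_map_lt (M : nat -> nat) s i : (i < length s)%nat -> nth i (map M s) O = M (nth i s O).
Proof.
  intros H. rewrite (nth_indep _ O (M O)) by (now rewrite length_map). apply map_nth.
Qed.

Lemma infinite_enum_lt M : infinite_enum M -> forall p q, (p < q)%nat -> (M p < M q)%nat.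
Proof.
  intros H p q Hpq. induction q as [|q IH]; [lia|]. specialize (H q).
  destruct (Nat.eq_dec p q) as [->|]; [easy|]. assert (M p < M q)%nat by (apply IH; lia). lia.
Qed.

Lemma infinite_enum_le M : infinite_enum M -> forall p q, (p <= q)%nat -> (M p <= M q)%nat.
Proof.
  intros H p q Hpq. destruct (Nat.eq_dec p q) as [->|]; [easy|].
  apply Nat.lt_le_incl, infinite_enum_lt; [easy|lia].
Qed.

Lemma infinite_enum_ge M : infinite_enum M -> forall p, (p <= M p)%nat.
Proof.
  intros H p. induction p as [|p IH]; [lia|]. specialize (H p). lia.
Qed.

Lemma kset_map k M s : infinite_enum M -> kset k s -> kset k (map M s).
Proof.
  intros HM [H1 H2]. split; [now rewrite length_map|]. intros i Hi.
  rewrite !nth_map_lt by lia. apply infinite_enum_lt; auto.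
Qed.

Lemma in_M_map M s : in_M M (map M s).
Proof. intros v Hv. apply in_map_iff in Hv. destruct Hv as [t [H _]]. now exists t. Qed.

Lemma plegma_family_map k m ss M :
  infinite_enum M -> (1 <= m)%nat -> plegma_family all_N k m ss ->
  plegma_family M k m (fun j => map M (ss j)).
Proof.
  intros HM Hm [H1 [H2 H3]].
  assert (Hlen : forall j, (j < m)%nat -> length (ss j) = k) by (intros j Hj; now apply H1).
  split; [|split].
  - intros j Hj. split; [|apply in_M_map]. apply kset_map; [easy|]. now apply H1.
  - intros j i Hj Hi. rewrite !nth_map_lt by (rewrite Hlen; lia). apply infinite_enum_lt; auto.
  - intros _ i Hi. rewrite !nth_map_lt by (rewrite Hlen; lia). apply infinite_enum_lt; auto.
Qed.

Lemma plegma_decode_family k m s :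
  kset (m * k) s -> plegma_family all_N k m (plegma_decode k m s).
Proof.
  intros Hs.
  assert (Hn : forall j i, (i < k)%nat -> nth i (plegma_decode k m s j) O = nth (i * m + j) s O).
  { intros j i Hi. unfold plegma_decode. now rewrite nth_map_seq. }
  split; [|split].
  - intros j Hj. split; [split|].
    + unfold plegma_decode. now rewrite length_map, length_seq.
    + intros i Hi. rewrite !Hn by lia. apply (kset_nth_lt _ _ _ _ Hs). nia.
    + intros v _. now exists v.
  - intros j i Hj Hi. rewrite !Hn by lia. apply (kset_nth_lt _ _ _ _ Hs). nia.
  - intros Hm i Hi. rewrite !Hn by lia. apply (kset_nth_lt _ _ _ _ Hs). nia.
Qed.

Lemma plegma_family_head_le M k m ss j i :
  plegma_family M k m ss -> (j < m)%nat -> (i < k)%nat ->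
  (nth 0 (ss O) O <= nth i (ss j) O)%nat.
Proof.
  intros [H1 [H2 _]] Hj Hi.
  assert (K : (nth 0 (ss O) O <= nth 0 (ss j) O)%nat).
  { induction j as [|j IH]; [lia|]. specialize (H2 j O ltac:(lia) ltac:(lia)).
    replace (j + 1)%nat with (S j) in H2 by lia. specialize (IH ltac:(lia)). lia. }
  destruct i as [|i]; [easy|]. destruct (H1 j Hj) as [Hs _].
  pose proof (kset_nth_lt _ _ 0 (S i) Hs ltac:(lia)). lia.
Qed.

(** * Decomposition of the k-sequence and the l1 component *)

(* [T r t] is the [r]-fold iterated limit at a list [t] of length [k - r], so that this is
   [x_(s|j) - x_(s|j-1)] for [j >= 1] and the constant [x_()] for [j = 0]. *)
Definition tree_part {X : SeminormedSpace} (k : nat) (T : nat -> list nat -> X) (j : nat)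
    (s : list nat) : X :=
  match j with
  | O => T k []
  | S i => (T (k - S i)%nat (firstn (S i) s) - T (k - i)%nat (firstn i s))%V
  end.

Section Decomposition.
Variable U : (nat -> Prop) -> Prop.
Hypothesis HU : ultra U.
Hypothesis U_free : forall n, U (fun i => (n < i)%nat).
Variable k : nat.
Hypothesis Hk : (1 <= k)%nat.
Variable X : SeminormedSpace.
Local Open Scope vec_scope.

(** Telescoping: the parts up to index [j] add up to the limit attached to the first [j] entries. *)
Lemma tree_part_sum (T : nat -> list nat -> X) s :
  length s = k -> T O s = vsum (S k) (fun j => tree_part k T j s).
Proof.
  intros Hs.
  assert (K : forall j, (j <= k)%nat ->
    vsum (S j) (fun j => tree_part k T j s) = T (k - j)%nat (firstn j s)).
  { induction j as [|j IH]; intros Hj.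
    - cbn. rewrite Nat.sub_0_r. vec.
    - cbn [vsum] in IH |- *. rewrite IH by lia. unfold tree_part. vec. }
  rewrite K by lia. now rewrite Nat.sub_diag, <- Hs, firstn_all.
Qed.

Lemma tree_part_bounded (T : nat -> list nat -> X) j :
  (forall r, exists B, bounded_by X B (T r)) -> exists B, bounded_by X B (tree_part k T j).
Proof.
  intros H. destruct j as [|i].
  - destruct (H k) as [B HB]. exists B. intros s. apply HB.
  - destruct (H (k - S i)%nat) as [B HB]. destruct (H (k - i)%nat) as [B' HB'].
    exists (B + B')%R. intros s. cbn [tree_part]. eapply Rle_trans; [apply norm_sub_le|].
    apply Rplus_le_compat; auto.
Qed.

Lemma plegma_lim_sum (x : list nat -> X) p (ys : nat -> list nat -> X) B m a :
  bounded_by X B x -> (forall j, exists B, bounded_by X B (ys j)) ->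
  (forall s, length s = k -> x s = vsum p (fun j => ys j s)) ->
  plegma_lim U k X x m a <= rsum p (fun j => plegma_lim U k X (ys j) m a).
Proof.
  intros HB HBs Hx. pose proof (iter_q_ultra U HU (m * k) []) as HQ.
  (* One error for [x] and one for each of the [p] parts, all evaluated at a common list. *)
  apply le_of_eps with (1 + INR p)%R. intros eps Heps.
  assert (K : iter_q U (m * k) (fun s => Rabs (plegma_norm k X x m a s - plegma_lim U k X x m a) < eps /\
     forall j, (j < p)%nat ->
       Rabs (plegma_norm k X (ys j) m a s - plegma_lim U k X (ys j) m a) < eps) []).
  { apply (ultra_and _ HQ).
    - now apply (plegma_lim_spec U HU k X x B m a HB).
    - apply (ultra_forall_lt HQ). intros j _. destruct (HBs j) as [B' HB'].
      now apply (plegma_lim_spec U HU k X (ys j) B' m a HB'). }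
  apply (ultra_ex HQ) in K. destruct K as [s [H1 H2]].
  assert (H3 : plegma_norm k X x m a s <= rsum p (fun j => plegma_norm k X (ys j) m a s)).
  { unfold plegma_norm at 1.
    rewrite (vsum_ext _ m _ (fun i => vsum p (fun j => a i *: ys j (plegma_decode k m s i)))).
    - rewrite vsum_exchange. apply norm_vsum_le.
    - intros i Hi. rewrite Hx; [now rewrite vsum_scal|].
      unfold plegma_decode. now rewrite length_map, length_seq. }
  assert (H4 : rsum p (fun j => plegma_norm k X (ys j) m a s)
    <= rsum p (fun j => plegma_lim U k X (ys j) m a) + INR p * eps).
  { rewrite <- rsum_const. clear -H2. induction p as [|p IH]; cbn; [lra|].
    pose proof (H2 p ltac:(lia)) as K. apply Rabs_def2 in K.
    specialize (IH ltac:(intros; apply H2; lia)). lra. }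
  apply Rabs_def2 in H1. lra.
Qed.

Lemma constant_lacks_l1 (v : X) : lacks_l1 U k X (fun _ => v).
Proof.
  intros eps Heps. exists 2%nat, (fun j => if Nat.eqb j 0 then / 2 else - / 2)%R. split.
  - cbn. rewrite Rabs_right by lra. rewrite Rabs_left by lra. field.
  - pose proof (iter_q_ultra U HU (2 * k) []) as HQ.
    replace (plegma_lim U k X _ _ _) with 0%R; [lra|]. symmetry.
    apply plegma_lim_unique with (\| v |); [easy|intros s; lra|].
    apply (qlim_ext HQ (fun _ => 0)); [|apply (qlim_const HQ)].
    intros s. unfold plegma_norm. cbn [vsum Nat.eqb].
    match goal with |- _ = \| ?w | => replace w with (sn_zero : X) by vec end.
    now rewrite norm_zero.
Qed.

Lemma tree_part_l1 (T : nat -> list nat -> X) c :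
  (forall r, exists B, bounded_by X B (T r)) -> 0 < c ->
  (forall m a, rsum m (fun j => Rabs (a j)) = 1 -> c <= plegma_lim U k X (T O) m a) ->
  exists j, (j < k)%nat /\ exists c', 0 < c' /\
    forall m a, c' * rsum m (fun i => Rabs (a i)) <= plegma_lim U k X (tree_part k T (S j)) m a.
Proof.
  intros HT Hc Hlow.
  assert (K : exists j, (j < S k)%nat /\ ~ lacks_l1 U k X (tree_part k T j)).
  { apply NNPP. intros H.
    assert (Hp : 0 < INR (S k)) by (apply lt_0_INR; lia).
    (* The [S k] parts together then contribute at most [c / 2], which contradicts the lower bound
       [c]. *)
    destruct (lacks_l1_common U HU U_free k Hk X (map (tree_part k T) (seq 0 (S k))))
      with (eps := (c / (2 * INR (S k)))%R) as [m [a [Ha1 Ha2]]].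
    - intros y Hy. apply in_map_iff in Hy. destruct Hy as [j [<- Hj]]. apply in_seq in Hj.
      split; [now apply tree_part_bounded|]. apply NNPP. intros K. apply H. exists j. split; [lia|easy].
    - apply Rdiv_lt_0_compat; lra.
    - specialize (Hlow m a Ha1). destruct (HT O) as [B HB].
      pose proof (plegma_lim_sum (T O) (S k) (tree_part k T) B m a HB
        (fun j => tree_part_bounded T j HT) (tree_part_sum T)) as K1.
      assert (K2 : rsum (S k) (fun j => plegma_lim U k X (tree_part k T j) m a)
        <= rsum (S k) (fun _ => c / (2 * INR (S k)))%R).
      { apply rsum_le. intros j Hj. apply Ha2. apply in_map. apply in_seq. lia. }
      rewrite rsum_const in K2.
      replace (INR (S k) * (c / (2 * INR (S k))))%R with (c / 2)%R in K2 by (field; lra). lra. }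
  destruct K as [[|j] [Hj K]].
  - exfalso. apply K. apply constant_lacks_l1.
  - exists j. split; [lia|]. destruct (tree_part_bounded T (S j) HT) as [B HB].
    now apply not_lacks_l1 with B.
Qed.

End Decomposition.

(** Off the k-sets the value at the first k-set is substituted: boundedness and membership in the
    compact set are required at all lists, whereas [x] is controlled only on k-sets. *)
Definition along (k : nat) {X : SeminormedSpace} (x : ksequence X) (M : nat -> nat) (s : list nat) : X :=
  if excluded_middle_informative (kset k s) then x (map M s) else x (map M (seq 0 k)).

Lemma seq_kset k : kset k (seq 0 k).
Proof.
  split; [apply length_seq|]. intros i Hi. rewrite !seq_nth by lia. lia.
Qed.

Section SpreadingModel.
Variable U : (nat -> Prop) -> Prop.
Hypothesis HU : ultra U.
Hypothesis U_free : forall n, U (fun i => (n < i)%nat).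
Variable k : nat.
Hypothesis Hk : (1 <= k)%nat.
Variables (X : SeminormedSpace) (x : ksequence X) (M : nat -> nat).
Variables (E : SeminormedSpace) (e : nat -> E).
Hypothesis HM : infinite_enum M.
Hypothesis Hgen : generates_spreading_model k x M E e.
Local Open Scope vec_scope.

Lemma along_range s : exists s', kset k s' /\ along k x M s = x (map M s').
Proof.
  unfold along. destruct excluded_middle_informative as [H|H].
  - now exists s.
  - exists (seq 0 k). split; [apply seq_kset|easy].
Qed.

(** A single set is a plegma family of length one, so the spreading model estimate with [l = 1]
    bounds every vector. *)
Lemma along_bounded : exists B, bounded_by X B (along k x M).
Proof.
  destruct Hgen as [delta [_ [_ H]]].
  exists (\| vsum 1 (fun j => 1 *: e j) | + delta 1%nat)%R. intros s.
  destruct (along_range s) as [s' [Hs ->]].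
  specialize (H 1%nat 1%nat (fun _ => map M s') (fun _ => 1)).
  assert (K : plegma_family M k 1 (fun _ => map M s')).
  { split; [|split].
    - intros j _. split; [now apply kset_map|apply in_M_map].
    - intros; lia.
    - intros _ i Hi. now apply (kset_map k M s' HM Hs). }
  specialize (H ltac:(lia) ltac:(lia) K). cbn beta in H.
  rewrite nth_map_lt in H by (destruct Hs; lia).
  specialize (H (infinite_enum_le M HM _ _ (Nat.le_0_l _)) ltac:(intros; lra)).
  cbn [vsum] in H |- *. replace (sn_zero + 1 *: x (map M s')) with (x (map M s')) in H by vec.
  apply Rabs_le_inv in H. lra.
Qed.

Lemma along_l1 c :
  (forall n a, c * rsum n (fun j => Rabs (a j)) <= \| vsum n (fun j => a j *: e j) |) ->
  forall m a, rsum m (fun j => Rabs (a j)) = 1 -> c <= plegma_lim U k X (along k x M) m a.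
Proof.
  intros Hc m a Ha. destruct (rsum_abs_one m a Ha) as [Hm Ha1].
  destruct along_bounded as [B HB]. destruct Hgen as [delta [Hd1 [Hd2 H]]].
  pose proof (iter_q_ultra U HU (m * k) []) as HQ.
  apply le_of_eps with 2. intros eps Heps.
  (* The model estimate needs [m <= l] and a small [delta l]; the list [s] found below has all its
     entries at least [l]. *)
  destruct (Hd2 eps Heps) as [L HL]. set (l := Nat.max L m).
  generalize (ultra_and _ HQ _ _ (plegma_lim_spec U HU k X _ B m a HB eps Heps)
    (iter_q_kset U HU U_free (m * k) l)).
  intros K. apply (ultra_ex HQ) in K. destruct K as [s [K1 [K2 K3]]].
  pose proof (plegma_decode_family k m s K2) as Hfam.
  specialize (H l m (fun j => map M (plegma_decode k m s j)) a ltac:(lia) ltac:(lia)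
    (plegma_family_map k m _ M HM Hm Hfam)).
  cbn beta in H.
  assert (Hlen : length (plegma_decode k m s O) = k)
    by (unfold plegma_decode; now rewrite length_map, length_seq).
  rewrite nth_map_lt in H by lia.
  assert (Hl : (l <= nth 0 (plegma_decode k m s 0) 0)%nat).
  { unfold plegma_decode. rewrite nth_map_seq by easy. apply K3, nth_In.
    destruct K2 as [-> _]. assert (0 < m * k)%nat by (apply Nat.mul_pos_pos; lia). lia. }
  specialize (H (infinite_enum_le M HM (l - 1) _ (Nat.le_trans _ _ _ (Nat.le_sub_l l 1) Hl)) Ha1).
  rewrite (vsum_ext X m _ (fun j => a j *: along k x M (plegma_decode k m s j))) in H.
  - fold (plegma_norm k X (along k x M) m a s) in H.
    specialize (HL l ltac:(lia)). unfold R_dist in HL. rewrite Rminus_0_r in HL.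
    specialize (Hc m a). rewrite Ha in Hc.
    apply Rabs_le_inv in H. apply Rabs_def2 in HL, K1. lra.
  - intros j Hj. unfold along. destruct excluded_middle_informative as [Hks|Hks]; [easy|].
    exfalso. apply Hks. now apply Hfam.
Qed.

End SpreadingModel.

(** * The block k-sequence *)

Section Block.
Variable U : (nat -> Prop) -> Prop.
Hypothesis HU : ultra U.
Hypothesis U_free : forall n, U (fun i => (n < i)%nat).
Variable X : SeminormedSpace.
Variable b : nat -> X.
Hypothesis HX : is_banach X.
Hypothesis Hb : schauder_basis b.
Variables k i0 : nat.
Hypothesis Hi0 : (i0 < k)%nat.
Variable w : list nat -> X.
Hypothesis Hnull : forall t, length t = i0 ->
  forall j, qlim U (fun i => coord b (w (t ++ [i])) j) 0.
Local Open Scope vec_scope.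

(** Squared because up to [l] errors of size [2 * err l] are summed, and the total must still tend
    to zero. *)
Let err (n : nat) : R := (/ INR (S n) * / INR (S n))%R.

Lemma err_pos n : 0 < err n.
Proof. apply Rmult_lt_0_compat; apply inv_INR_pos. Qed.

Lemma err_le n m : (n <= m)%nat -> err m <= err n.
Proof.
  intros H. assert (/ INR (S m) <= / INR (S n)).
  { apply Rinv_le_contravar; [apply lt_0_INR; lia|apply le_INR; lia]. }
  pose proof (inv_INR_pos m). unfold err. apply Rmult_le_compat; lra.
Qed.

(** Only finitely many lists have entries up to [N], so one cutoff serves all of them; the running
    maximum makes it monotone. *)
Lemma tail_cutoff : exists q : nat -> nat,
  (forall n m, (n <= m)%nat -> (q n <= q m)%nat) /\
  forall N t, (forall v, In v t -> (v <= N)%nat) -> length t = S i0 ->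
    \| psum b (q N) (w t) - w t | <= err N.
Proof.
  assert (H : forall N, exists Q, forall t, (forall v, In v t -> (v <= N)%nat) -> length t = S i0 ->
    forall q, (Q <= q)%nat -> \| psum b q (w t) - w t | <= err N).
  { intros N. destruct (lists_over_finite (seq 0 (S N)) (S i0)) as [L HL].
    destruct (uniform_tail X b Hb (map w L) (err N) (err_pos N)) as [Q HQ].
    exists Q. intros t Ht1 Ht2 q Hq. left. apply HQ; [|easy]. apply in_map, HL; [|lia].
    intros v Hv. apply in_seq. specialize (Ht1 v Hv). lia. }
  apply choice in H. destruct H as [q0 Hq0].
  exists (fun N => list_max (map q0 (seq 0 (S N)))).
  assert (Hle : forall n m, (n <= m)%nat -> (q0 n <= list_max (map q0 (seq 0 (S m))))%nat).
  { intros n m Hn. pose proof (proj1 (list_max_le (map q0 (seq 0 (S m))) _) (Nat.le_refl _)) as K.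
    rewrite Forall_forall in K. apply K, in_map, in_seq. lia. }
  split.
  - intros n m Hn. apply list_max_le. apply Forall_forall. intros v Hv.
    apply in_map_iff in Hv. destruct Hv as [u [<- Hu]]. apply in_seq in Hu. apply Hle. lia.
  - intros N t Ht1 Ht2. apply Hq0; auto.
Qed.

Let y (s : list nat) : X := w (firstn (S i0) s).

(** Let [p] be entry [i0] of the position set [s]. The vector at [map M s] is cut to the coordinates
    from [q (M (p - 1))] up to [q (M p)]; in a plegma pair [p] strictly increases, so these
    intervals do not overlap. The enumeration [S] makes the head of a family at least [l], as
    [plegma_ramsey] demands, and keeps [p] positive. *)
Lemma block_approximation B :
  bounded_by X B y -> exists z : ksequence X, plegma_block b k z /\
    forall (E : SeminormedSpace) (e : nat -> E),
      (forall n a, \| vsum n (fun j => a j *: e j) | = plegma_lim U k X y n a) ->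
      generates_spreading_model k z S E e.
Proof.
  intros HB. destruct tail_cutoff as [q [Hq1 Hq2]].
  (* In the selection [last F O] is the preceding element of [M]: the next index is taken so far out
     that the coordinates below the preceding cutoff are negligible. *)
  set (G := fun (F : list nat) (i : nat) => forall t, incl t F -> length t = i0 ->
    \| psum b (q (last F O)) (w (t ++ [i])) | <= err (length F)).
  destruct (plegma_ramsey U HU U_free k ltac:(lia) X y B G HB) as [M [HM1 [HM2 HM3]]].
  { intros F. destruct (lists_over_finite F i0) as [L HL].
    assert (K : U (fun i => forall t, In t L -> length t = i0 ->
      \| psum b (q (last F O)) (w (t ++ [i])) | < err (length F))).
    { apply (ultra_forall_list HU L). intros t _. apply (ultra_imp HU). intros Ht.
      apply (psum_null U HU X b HX Hb (q (last F O)) (fun i => w (t ++ [i]))); [auto|apply err_pos]. }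
    revert K. apply (ultra_mono _ HU). intros i Hi t Ht1 Ht2. left. apply Hi; [|easy].
    apply HL; [easy|lia]. }
  set (p := fun s : list nat => nth i0 s O).
  (* At [p s = 0] truncated subtraction makes this vector zero, which is still compatible with the
     block condition. *)
  exists (fun s => psum b (q (M (p s))) (y (map M s)) - psum b (q (M (p s - 1)%nat)) (y (map M s))).
  assert (Hcoord : forall s n, coord b
     (psum b (q (M (p s))) (y (map M s)) - psum b (q (M (p s - 1)%nat)) (y (map M s))) n
     = ((if Nat.ltb n (q (M (p s))) then coord b (y (map M s)) n else 0)
       - (if Nat.ltb n (q (M (p s - 1)%nat)) then coord b (y (map M s)) n else 0))%R).
  { intros s n. rewrite coord_sub, !coord_psum by easy. easy. }
  assert (Hq3 : forall n m, (n <= m)%nat -> (q (M n) <= q (M m))%nat).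
  { intros n m Hn. now apply Hq1, infinite_enum_le. }
  assert (Hbelow : forall s, supp_below b
     (psum b (q (M (p s))) (y (map M s)) - psum b (q (M (p s - 1)%nat)) (y (map M s))) (q (M (p s)))).
  { intros s a Ha n Hn. rewrite <- (coord_unique X b Hb _ _ Ha), Hcoord.
    pose proof (Hq3 (p s - 1)%nat (p s) ltac:(lia)).
    destruct (Nat.ltb_spec n (q (M (p s)))); [lia|].
    destruct (Nat.ltb_spec n (q (M (p s - 1)%nat))); [lia|]. lra. }
  split; [split|].
  - intros s _. now exists (q (M (p s))).
  - intros s1 s2 [_ [H _]]. specialize (H O i0 ltac:(lia) Hi0). cbn in H.
    fold (p s1) (p s2) in H.
    exists (q (M (p s1))). split; [apply Hbelow|].
    intros a Ha n Hn. rewrite <- (coord_unique X b Hb _ _ Ha), Hcoord.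
    pose proof (Hq3 (p s1) (p s2 - 1)%nat ltac:(lia)).
    pose proof (Hq3 (p s1) (p s2) ltac:(lia)).
    destruct (Nat.ltb_spec n (q (M (p s2)))); [|lia].
    destruct (Nat.ltb_spec n (q (M (p s2 - 1)%nat))); [|lia]. lra.
  (* One unit for the Ramsey error and two for the coordinates cut off on both sides. *)
  - intros E e He. exists (fun l => 3 * / INR (S l))%R. split; [|split].
    + intros l. pose proof (inv_INR_pos l). lra.
    + intros eps Heps. destruct (rinv_small (eps / 3) ltac:(lra)) as [N HN]. exists N.
      intros n Hn. specialize (HN n Hn). pose proof (inv_INR_pos n). unfold R_dist.
      rewrite Rabs_right; lra.
    + intros l m ss a Hl Hm Hss Hhead Ha. rewrite He.
      replace (S (l - 1)) with l in Hhead by lia.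
      assert (Hss' : plegma_family all_N k m ss).
      { destruct Hss as [H1 H2]. split; [|easy]. intros j Hj. split; [now apply H1|].
        intros v _. now exists v. }
      specialize (HM3 l m a ss Hm Ha Hss' Hhead).
      set (z := fun s => psum b (q (M (p s))) (y (map M s)) - psum b (q (M (p s - 1)%nat)) (y (map M s))).
      assert (Hz : forall j, (j < m)%nat -> \| z (ss j) - y (map M (ss j)) | <= 2 * err l).
      { intros j Hj. pose proof (plegma_family_head_le _ k m ss j i0 Hss' Hj Hi0) as Hp.
        destruct (proj1 Hss' j Hj) as [Hks _]. set (s := ss j) in *. fold (p s) in Hp.
        pose proof Hks as [Hlen _].
        assert (Hfirst : firstn (S i0) (map M s) = map M (firstn i0 s) ++ [M (p s)]).
        { rewrite firstn_map, (firstn_snoc O) by lia. now rewrite map_app. }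
        assert (Hbefore : forall u, In u (firstn i0 s) -> (u < p s)%nat).
        { intros u Hu. apply (In_nth _ _ O) in Hu. destruct Hu as [i [Hi <-]].
          rewrite length_firstn in Hi. rewrite nth_firstn.
          destruct (Nat.ltb_spec i i0); [|lia].
          apply kset_nth_lt with k; [easy|lia]. }
        pose proof (HM2 (p s) (map M (firstn i0 s))) as K1.
        rewrite (length_map M (seq 0 (p s))), length_seq in K1.
        replace (last (map M (seq 0 (p s))) O) with (M (p s - 1)%nat) in K1.
        2: { replace (p s) with (S (p s - 1)) at 2 by lia.
             rewrite seq_S, map_app. cbn [map]. now rewrite last_last. }
        rewrite <- Hfirst in K1. fold (y (map M s)) in K1.
        assert (K2 : \| psum b (q (M (p s - 1)%nat)) (y (map M s)) | <= err l).
        { eapply Rle_trans; [apply K1|apply err_le; lia].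
          - intros v Hv. apply in_map_iff in Hv. destruct Hv as [u [<- Hu]]. apply in_map, in_seq.
            specialize (Hbefore u Hu). lia.
          - rewrite length_map, length_firstn. lia. }
        assert (K3 : \| psum b (q (M (p s))) (y (map M s)) - y (map M s) | <= err l).
        { eapply Rle_trans; [apply Hq2|apply err_le].
          - intros v Hv. rewrite Hfirst in Hv. apply in_app_or in Hv.
            destruct Hv as [Hv|[<-|[]]]; [|easy].
            apply in_map_iff in Hv. destruct Hv as [u [<- Hu]]. apply infinite_enum_le; [easy|].
            specialize (Hbefore u Hu). lia.
          - rewrite length_firstn, length_map. lia.
          - pose proof (infinite_enum_ge M HM1 (p s)). lia. }
        unfold z.
        replace (psum b (q (M (p s))) (y (map M s)) - psum b (q (M (p s - 1)%nat)) (y (map M s))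
            - y (map M s))
          with ((psum b (q (M (p s))) (y (map M s)) - y (map M s))
            - psum b (q (M (p s - 1)%nat)) (y (map M s))) by vec.
        eapply Rle_trans; [apply norm_sub_le|]. lra. }
      change (Rabs (\| vsum m (fun j => a j *: z (ss j)) | - plegma_lim U k X y m a)
        <= 3 * / INR (S l)).
      set (A := vsum m (fun j => a j *: z (ss j))).
      set (A' := vsum m (fun j => a j *: y (map M (ss j)))) in *.
      assert (HA : \| A - A' | <= 2 * / INR (S l)).
      { unfold A, A'. rewrite vsum_sub.
        rewrite (vsum_ext _ m _ (fun j => a j *: (z (ss j) - y (map M (ss j))))) by (intros; vec).
        eapply Rle_trans; [apply norm_lincomb_le, Hz|].
        apply Rle_trans with (INR (S l) * (2 * err l))%R.
        - pose proof (err_pos l). apply Rmult_le_compat_r; [lra|].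
          apply Rle_trans with (rsum m (fun _ => 1)).
          + apply rsum_le. intros j Hj. apply Rabs_le. auto.
          + rewrite rsum_const, Rmult_1_r. apply le_INR. lia.
        - unfold err. right. field. apply not_0_INR. lia. }
      pose proof (norm_le_sub X A A'). pose proof (norm_le_sub X A' A) as HA2.
      rewrite (norm_sub_sym X A' A) in HA2.
      apply Rabs_le_inv in HM3. apply Rabs_le. lra.
Qed.

End Block.

Theorem mainTheorem11 :
  forall (X : SeminormedSpace) (b : nat -> X) (k : nat),
    is_banach X -> schauder_basis b -> (1 <= k)%nat ->
    (exists (E : SeminormedSpace) (e : nat -> E), in_SM_wrc X k E e /\ equiv_l1 e) ->
    exists (x : ksequence X) (M : nat -> nat) (E : SeminormedSpace) (e : nat -> E),
      plegma_block b k x /\ infinite_enum M /\ hamel_basis e /\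
      generates_spreading_model k x M E e /\ equiv_l1 e.
Proof.
  intros X b k HX Hb Hk [E0 [e0 [[_ [x [M0 [Hwrc [HM0 Hgen]]]]] [c0 [C0 [Hc0 [_ Hl1]]]]]]].
  destruct free_ultrafilter as [U [HU U_free]].
  destruct (along_bounded k Hk X x M0 E0 e0 HM0 Hgen) as [B0 HB0].
  destruct (iterated_ultralimits U HU X b HX Hb _ (along k x M0) B0 Hwrc) as [T [HT0 [HT1 HT2]]].
  { intros s fs eps _ Heps. destruct (along_range k X x M0 s) as [s' [Hs' ->]].
    exists (x (map M0 s')). split.
    - exists (map M0 s'). split; [now apply kset_map|easy].
    - intros f _. now rewrite Rminus_diag, Rabs_R0. }
  { exact HB0. }
  destruct (tree_part_l1 U HU U_free k Hk X T c0 HT2 Hc0) as [j [Hj [c [Hc Hlow]]]].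
  { rewrite HT0. apply (along_l1 U HU U_free k Hk X x M0 E0 e0 HM0 Hgen).
    intros n a. apply Hl1. }
  (* The chosen part is viewed as a function of the first [S j] entries, since it is the last of
     these that tends to infinity in the sliding hump. *)
  set (w := fun t => (T (k - S j)%nat t - T (k - j)%nat (firstn j t))%V).
  assert (Hw : tree_part k T (S j) = fun s => w (firstn (S j) s)).
  { apply functional_extensionality. intros s. unfold w. cbn [tree_part].
    rewrite firstn_firstn. now replace (Nat.min j (S j)) with j by lia. }
  destruct (tree_part_bounded k X T (S j) HT2) as [B HB].
  rewrite Hw in Hlow, HB.
  destruct (block_approximation U HU U_free X b HX Hb k j Hj w) with (B := B) as [z [Hz1 Hz2]].
  (* The subtracted vector depends on [t] alone and is, by construction, the coordinatewise limit of
     the other one over the appended entry. *)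
  { intros t Ht i.
    assert (K : forall n, w (t ++ [n]) = (T (k - S j)%nat (t ++ [n]) - T (S (k - S j)) t)%V).
    { intros n. unfold w. rewrite <- Ht, firstn_app, Nat.sub_diag, firstn_all, app_nil_r.
      replace (S (k - S (length t))) with (k - length t)%nat by lia. easy. }
    apply (qlim_ext HU (fun n => coord b (T (k - S j)%nat (t ++ [n]) - T (S (k - S j)) t)%V i)).
    - intros n. now rewrite K.
    - apply (coord_qlim_sub U HU X b Hb (fun n => T (k - S j)%nat (t ++ [n]))). apply HT1. }
  { exact HB. }
  set (y := fun s => w (firstn (S j) s)) in *.
  destruct (c00_seminorm_space (plegma_lim U k X y)) as [E [e [He1 He2]]].
  { intros n a a'. now apply plegma_lim_ext with B. }
  { intros n m a. now apply plegma_lim_pad with B. }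
  { intros n a d. now apply plegma_lim_homog with B. }
  { intros n a a'. now apply plegma_lim_triangle with B. }
  exists z, S, E, e. split; [easy|]. split; [intros t; lia|]. split; [easy|].
  split; [now apply Hz2|].
  exists c, (Rabs B + 1). split; [easy|]. split; [pose proof (Rabs_pos B); lra|].
  intros n a. rewrite He2. split; [apply Hlow|].
  eapply Rle_trans; [now apply plegma_lim_upper with (B := B)|].
  rewrite Rmult_comm. apply Rmult_le_compat_r.
  - apply rsum_nonneg. intros. apply Rabs_pos.
  - pose proof (Rle_abs B). lra.
Qed.
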